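(* Let $N\ge1$ be an integer and let $p,a,b$ be real numbers with $p>1$, $\frac1p+\frac aN>0$, $0\le a-b\le 1$, and $q^{\ast}=\frac{Np}{N-p+p(a-b)}>1$. Then $$D_{a,0}^{1,p}(\mathbb{Z}^N)=D_a^{1,p}(\mathbb{Z}^N).$$
   Context: $\mathbb{Z}^N$ denotes the integer lattice graph: the vertices are the points of $\mathbb{Z}^N$, and $x\sim y$ (neighbors) iff $\sum_{i=1}^N|x_i-y_i|=1$. Let $d(x)$ be the combinatorial (graph) distance from $x$ to the origin. For $s\in\mathbb{R}$ define the weight $\mu_s(x)=(1+d(x))^s$ on $\mathbb{Z}^N$. For $1\le t<\infty$, $\ell_b^{t}(\mathbb{Z}^N)$ is the space of functions $u$ on $\mathbb{Z}^N$ with $\|u\|_{\ell_b^t}=\big(\sum_{x}\mu_{bt}(x)|u(x)|^t\big)^{1/t}<\infty$. Set $\|u\|_{D_a^{1,p}(\mathbb{Z}^N)}=\big(\sum_{x}\sum_{y\sim x}\mu_{ap}(x)|u(y)-u(x)|^p\big)^{1/p}$. $D_{a,0}^{1,p}(\mathbb{Z}^N)$ is the completion of the space of finitely supported functions on $\mathbb{Z}^N$ in the norm $\|\cdot\|_{D_a^{1,p}(\mathbb{Z}^N)}$, and $$D_a^{1,p}(\mathbb{Z}^N)=\{u\in\ell_b^{q^{\ast}}(\mathbb{Z}^N):\ \|u\|_{D_a^{1,p}(\mathbb{Z}^N)}<\infty\}.$$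
   Formalization: The completion is read as the set of limits in ℓ_b^{q*} of D-Cauchy finitely supported functions; that it is a true completion in the D-norm is claimed only if 1/q*+b/N>0, as otherwise it fails (N=1, p=2, a=0, b=-1: constants lie in D_a with norm 0). *)

(* Defs.v *)
From HB Require Import structures.
From mathcomp Require Import all_boot all_order all_algebra.
From mathcomp Require Import all_classical all_reals all_analysis.
Set Implicit Arguments.
Unset Strict Implicit.
Unset Printing Implicit Defensive.
Import Order.TTheory GRing.Theory Num.Theory.
Import numFieldNormedType.Exports.
Local Open Scope classical_set_scope.
Local Open Scope ring_scope.

Definition lattice (N : nat) := 'rV[int]_N.

Definition lattice_adj (N : nat) : rel (lattice N) :=
  fun x y => \sum_(i < N) `|x ord0 i - y ord0 i| == 1.

(* The infimum is over the lengths of all walks from x to y. *)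
Definition graph_dist (R : realType) (N : nat) (x y : lattice N) : R :=
  inf [set (size s)%:R | s in
        [set s : seq (lattice N) | path (@lattice_adj N) x s /\ last x s = y]].

Definition lattice_weight (R : realType) (N : nat) (s : R) (x : lattice N) : R :=
  (1 + graph_dist R x 0) `^ s.

(* Both norms take values in [0, +oo]. *)
Definition lb_norm (R : realType) (N : nat) (b t : R) (u : lattice N -> R) :
    \bar R :=
  ((\esum_(x in [set: lattice N])
      (lattice_weight (b * t) x * `|u x| `^ t)%:E) `^ t^-1)%E.

Definition D_norm (R : realType) (N : nat) (a p : R) (u : lattice N -> R) :
    \bar R :=
  ((\esum_(x in [set: lattice N]) \esum_(y in [set y | lattice_adj x y])
      (lattice_weight (a * p) x * `|u y - u x| `^ p)%:E) `^ p^-1)%E.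

Definition lb_space (R : realType) (N : nat) (b t : R) : set (lattice N -> R) :=
  [set u | (lb_norm b t u < +oo)%E].

Definition finitely_supported (R : realType) (N : nat) : set (lattice N -> R) :=
  [set u | finite_set [set x | u x != 0]].

Definition norm_cauchy (R : realType) (T : Type)
    (nrm : (T -> R) -> \bar R) (f : nat -> T -> R) : Prop :=
  forall e : R, 0 < e -> exists n0 : nat, forall m n : nat,
    (n0 <= m)%N -> (n0 <= n)%N -> (nrm (f m \- f n)%R < e%:E)%E.

Definition norm_cvg (R : realType) (T : Type)
    (nrm : (T -> R) -> \bar R) (f : nat -> T -> R) (u : T -> R) : Prop :=
  nrm (f n \- u) @[n --> \oo] --> 0%E.

(* The space V of functions, with the norm nrm, is a completion of A: nrm is a
   finite norm on V, A is dense in V, and V is complete. *)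
Definition is_completion (R : realType) (T : Type)
    (nrm : (T -> R) -> \bar R) (A V : set (T -> R)) : Prop :=
  [/\ A `<=` V,
      forall u, V u -> (nrm u < +oo)%E,
      forall u v, V u -> V v -> nrm (u \- v) = 0%E -> u = v,
      forall u, V u -> exists f, (forall n, A (f n)) /\ norm_cvg nrm f u &
      forall f, (forall n, V (f n)) -> norm_cauchy nrm f ->
        exists u, V u /\ norm_cvg nrm f u].

Definition qstar (R : realType) (N : nat) (p a b : R) : R :=
  N%:R * p / (N%:R - p + p * (a - b)).

(* The completion of the finitely supported functions in D_norm, realized as a
   space of functions: the class of a D_norm-Cauchy sequence is identified with
   the limit of the sequence in the ambient space lb_space b (qstar N p a b).
   When 0 < 1/q* + b/N, D_norm dominates the norm of the ambient space on
   finitely supported functions, so every class has such a limit, and this set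
   is a completion in the sense of is_completion.  When 1/q* + b/N <= 0, i.e.
   N + a p <= p, suitable cut-offs of the constant 1 tend to 0 in D_norm, and the
   abstract completion does not embed in the functions on the lattice. *)
Definition D_space0 (R : realType) (N : nat) (p a b : R) :
    set (lattice N -> R) :=
  [set u | exists f : nat -> lattice N -> R,
     [/\ forall n, @finitely_supported R N (f n),
         norm_cauchy (D_norm a p) f &
         norm_cvg (lb_norm b (qstar N p a b)) f u]].

Definition D_space (R : realType) (N : nat) (p a b : R) :
    set (lattice N -> R) :=
  [set u | lb_space b (qstar N p a b) u /\ (D_norm a p u < +oo)%E].

(* Main.v *)
Require Import Defs.
From HB Require Import structures.
From mathcomp Require Import all_boot all_order all_algebra.
From mathcomp Require Import all_classical all_reals all_analysis.
From mathcomp Require Import ring lra zify.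
Set Implicit Arguments.
Unset Strict Implicit.
Unset Printing Implicit Defensive.
Import Order.TTheory GRing.Theory Num.Theory.
Import numFieldNormedType.Exports.
Local Open Scope classical_set_scope.
Local Open Scope ring_scope.

(** Write [wt x = 1 + |x|] for the weight, [tau = 1 - (a - b)] and
    [theta = p tau / N], so that [q (1 - theta) = p] for the exponent [q = q*].
    Only the smallness of norms matters, so both norms are replaced by the sums
    below their roots: the energy [sum wt^(a p) |grad u|^p] and the mass
    [sum wt^(b q) |u|^q].

    The two spaces are equal because cutting off a function of finite mass and
    finite energy at radius [n] changes little ([cutoff_approx]).  The cutoff
    costs [sum wt^(a p) |u|^p n^-p] over the shell [n <= |x| <= 2 n].  By the
    choice of [q] the summand there is at most a constant times
    [(n^-N)^theta X^(1 - theta)], [X] being the summand of the mass, hence at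
    most a constant times [delta n^-N + lambda X], where [delta] is as small as
    desired and [lambda] depends on [delta].  The shell has about [n^N] points,
    so the first part contributes [delta], and the second one is a tail of the
    mass.  Conversely an energy-Cauchy sequence that converges in mass converges
    pointwise, and Fatou's lemma makes it converge in energy.

    Completeness needs an inequality of Caffarelli-Kohn-Nirenberg type: when
    [N + a p - p > 0], the mass of a finitely supported function is bounded by a
    power of its energy ([weighted_sobolev]).  It rests on two estimates.
    - Hardy's inequality ([hardy]) bounds [sum wt^(a p - p) |u|^p] by the energy.
      There is an explicit flow on the edges of the lattice whose divergence is
      at least [c wt^(a p - p)]; one sums by parts and absorbs.
    - A weighted Faber-Krahn inequality ([weighted_faber_krahn]) bounds
      [sum wt^(b q) |v|^p] by [M^theta] times the energy plus the Hardy sum, [M]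
      being the weighted measure of a set that carries [v].  In a dyadic shell
      where that set is thin, at least half of the translates of a point by a
      cube of suitable side leave the set, and the values of [v] are recovered
      from differences along lattice walks ([local_poincare]); where the set is
      not thin, the Hardy sum alone suffices.

    To conclude, [|u|] is cut into slices between consecutive dyadic levels.  The
    energies of the slices add up to at most the energy of [u], and the
    Faber-Krahn inequality for each slice bounds the measure of the next level
    set by the mass to the power [theta]; summing over levels gives
    [mass <= C mass^theta energy], and [theta < 1]. *)

(** * Inequalities for real powers *)

Section real_inequalities.
Variable R : realType.
Implicit Types (a b c p q s t x y : R).

Lemma ler_powRl p x y : 0 <= p -> 0 <= x -> x <= y -> x `^ p <= y `^ p.
Proof.
move=> p0 x0 xy; apply: ge0_ler_powR => //; rewrite nnegrE //.
exact: le_trans xy.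
Qed.

Lemma powRDp (x r s : R) : 0 < x -> x `^ (r + s) = x `^ r * x `^ s.
Proof. by move=> x0; rewrite powRD//; apply/implyP => _; rewrite gt_eqF. Qed.

(** Young's inequality for [a] and [l^(p-1)]: the convex function [a^p] lies above
    its tangent at [l].  Both Jensen's inequality and the bound on [a^p - b^p]
    below are read off from it. *)
Lemma powR_tangent p a l : 1 < p -> 0 <= a -> 0 <= l ->
  p * l `^ (p - 1) * a <= a `^ p + (p - 1) * l `^ p.
Proof.
move=> p1 a0 l0.
have p0 : 0 < p by lra.
have pm : 0 < p - 1 by lra.
have pN : p - 1 != 0 by rewrite gt_eqF.
have := @conjugate_powR R a (l `^ (p - 1)) p (p / (p - 1)) a0 (powR_ge0 _ _)
  p0 (divr_gt0 p0 pm).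
rewrite invf_div -powRrM.
have -> : (p - 1) * (p / (p - 1)) = p by field.
have -> : p^-1 + (p - 1) / p = 1 by field; rewrite gt_eqF.
move=> /(_ erefl) h.
have -> : p * l `^ (p - 1) * a = p * (a * l `^ (p - 1)) by ring.
have -> : a `^ p + (p - 1) * l `^ p =
    p * (a `^ p / p + l `^ p * ((p - 1) / p)).
  by field; rewrite gt_eqF.
by rewrite ler_pM2l.
Qed.

(** Jensen: sum the tangent inequalities at the mean [l] of the terms. *)
Lemma powR_sum_le p (I : Type) (s : seq I) (a : I -> R) : 1 < p ->
    (forall i, 0 <= a i) ->
  (\sum_(i <- s) a i) `^ p <= (size s)%:R `^ (p - 1) * \sum_(i <- s) a i `^ p.
Proof.
move=> p1 a0.
have p0 : 0 < p by lra.
case: s => [|i0 s']; first by rewrite !big_nil powR0 ?gt_eqF// mulr0.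
set s := i0 :: s'.
have m0 : 0 < (size s)%:R :> R by rewrite ltr0n.
set A := \sum_(i <- s) a i.
have A0 : 0 <= A by apply: sumr_ge0.
set l := A / (size s)%:R.
have l0 : 0 <= l by rewrite divr_ge0// ltW.
have key : p * l `^ (p - 1) * A <=
    \sum_(i <- s) a i `^ p + (size s)%:R * ((p - 1) * l `^ p).
  have -> : (size s)%:R * ((p - 1) * l `^ p) = \sum_(i <- s) ((p - 1) * l `^ p).
    by rewrite big_const_seq count_predT iter_addr addr0 mulr_natl.
  rewrite -big_split /= mulr_sumr; apply: ler_sum => i _.
  exact: powR_tangent.
have Al : A = (size s)%:R * l by rewrite mulrC divfK// gt_eqF.
have e1 : p * l `^ (p - 1) * A = p * (size s)%:R * l `^ p.
  by rewrite -(mulr_powRB1 l0 p0) Al; ring.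
have {}key : (size s)%:R * l `^ p <= \sum_(i <- s) a i `^ p.
  by move: key; rewrite e1; lra.
rewrite Al powRM // ?(ltW m0)//.
rewrite -(mulr_powRB1 (ltW m0) p0) [X in X * _]mulrC -mulrA.
by rewrite ler_wpM2l ?powR_ge0.
Qed.

Lemma sum_powR_le p (I : Type) (s : seq I) (a : I -> R) : 1 < p ->
    (forall i, 0 <= a i) ->
  \sum_(i <- s) a i `^ p <= (\sum_(i <- s) a i) `^ p.
Proof.
move=> p1 a0; have p0 : 0 < p by lra.
elim: s => [|i s ih]; first by rewrite !big_nil powR_ge0.
rewrite !big_cons; set B := \sum_(_ <- _) a _ in ih *.
have B0 : 0 <= B by apply: sumr_ge0.
apply: le_trans (lerD (lexx _) ih) _.
rewrite -(mulr_powRB1 (a0 i) p0) -(mulr_powRB1 B0 p0) -[leRHS]mulr_powRB1 ?addr_ge0//.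
rewrite mulrDl lerD// ler_wpM2l// ler_powRl ?subr_ge0 ?(ltW p1)//.
  by rewrite lerDl.
by rewrite lerDr.
Qed.

(** A quasi-triangle inequality suffices wherever only smallness matters, and
    spares Minkowski's inequality. *)
Lemma powR_add_le p a b : 0 <= p -> 0 <= a -> 0 <= b ->
  (a + b) `^ p <= 2 `^ p * (a `^ p + b `^ p).
Proof.
move=> p0 a0 b0.
have [ab|/ltW ba] := leP a b.
  apply: (@le_trans _ _ ((2 * b) `^ p)).
    by apply: ler_powRl; lra.
  by rewrite powRM// ler_wpM2l ?powR_ge0// lerDr powR_ge0.
apply: (@le_trans _ _ ((2 * a) `^ p)).
  by apply: ler_powRl; lra.
by rewrite powRM// ler_wpM2l ?powR_ge0// lerDl powR_ge0.
Qed.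

(** Comparable radii give comparable weights whatever the sign of the exponent;
    all comparisons of weights go through this. *)
Lemma powR_comparable s c x y : 0 < x -> 0 < y -> 1 <= c ->
  x <= c * y -> y <= c * x -> x `^ s <= c `^ `|s| * y `^ s.
Proof.
move=> x0 y0 c1 xy yx; have c0 : 0 < c by lra.
have [s0|s0] := leP 0 s.
  rewrite ger0_norm// -powRM ?(ltW c0) ?(ltW y0)//.
  by apply: ler_powRl => //; exact: ltW.
rewrite ltr0_norm//.
have t0 : 0 <= - s by lra.
have es : s = - (- s) by rewrite opprK.
move: (- s) t0 es => t t0 -> {s s0}; rewrite !powRN.
rewrite -[leLHS]mul1r ler_pdivrMr ?powR_gt0//.
rewrite mulrAC ler_pdivlMr ?powR_gt0// mul1r -powRM ?(ltW c0) ?(ltW x0)//.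
by apply: ler_powRl => //; exact: ltW.
Qed.

Lemma powR_shift_near s K x y : 1 <= K -> 0 <= x -> 0 <= y ->
  x <= y + 1 -> y <= x + 1 -> (K + x) `^ s <= 2 `^ `|s| * (K + y) `^ s.
Proof. by move=> K1 x0 y0 xy yx; apply: powR_comparable; lra. Qed.

Lemma powR_shift s K x : 1 <= K -> 0 <= x ->
  (1 + x) `^ s <= K `^ `|s| * (K + x) `^ s /\
  (K + x) `^ s <= K `^ `|s| * (1 + x) `^ s.
Proof.
by move=> K1 x0; split; apply: powR_comparable; by [lra|nra].
Qed.

(** The geometric mean is at most the larger of the two terms.  Applied termwise
    with a free ratio between [a] and [b], this does the work of Hoelder's
    inequality for sums. *)
Lemma powR_interp t a b : 0 <= t <= 1 -> 0 <= a -> 0 <= b ->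
  a `^ t * b `^ (1 - t) <= a + b.
Proof.
move=> /andP[t0 t1] a0 b0.
have aux c : 0 <= c -> c `^ t * c `^ (1 - t) = c.
  move=> c0; rewrite -powRD; first by rewrite addrC subrK powRr1.
  by rewrite addrC subrK oner_eq0.
have [ab|/ltW ba] := leP a b.
  apply: (@le_trans _ _ (b `^ t * b `^ (1 - t))).
    by rewrite ler_wpM2r ?powR_ge0// ler_powRl.
  by rewrite aux// lerDr.
apply: (@le_trans _ _ (a `^ t * a `^ (1 - t))).
  by rewrite ler_wpM2l ?powR_ge0// ler_powRl ?subr_ge0.
by rewrite aux// lerDl.
Qed.

(** By convexity the left side is at most [Y m^(p-1)] with [m] the larger of [a] and
    [b] and [Y = p X |a - b|].  Either [Y <= e m], giving the first term, or
    [m < Y / e], giving the second. *)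
Lemma powR_diff_young p e : 1 < p -> 0 < e -> exists2 C, 0 <= C &
  forall X a b, 0 <= X -> 0 <= a -> 0 <= b ->
  X * `|a `^ p - b `^ p| <= e * (a `^ p + b `^ p) + C * (X * `|a - b|) `^ p.
Proof.
move=> p1 e0; have p0 : 0 < p by lra.
exists (p * (p / e) `^ (p - 1)); first by rewrite mulr_ge0 ?powR_ge0// ltW.
move=> X a b X0.
wlog ba : a b / b <= a.
  move=> H a0 b0; have [ab|/ltW ba] := leP a b; last exact: H.
  by rewrite distrC [a `^ p + _]addrC [`|a - b|]distrC; exact: H.
move=> a0 b0.
have bap : b `^ p <= a `^ p by apply: ler_powRl => //; exact: ltW.
rewrite !ger0_norm ?subr_ge0//.
set D := a - b.
have D0 : 0 <= D by rewrite subr_ge0.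
have h1 : a `^ p - b `^ p <= p * a `^ (p - 1) * D.
  have := powR_tangent p1 b0 a0.
  have := mulr_powRB1 a0 p0.
  by rewrite /D; nra.
have XD0 : 0 <= X * D by rewrite mulr_ge0.
apply: (@le_trans _ _ (p * (X * D) * a `^ (p - 1))).
  have -> : p * (X * D) * a `^ (p - 1) = X * (p * a `^ (p - 1) * D) by ring.
  by rewrite ler_wpM2l.
have [le_e|/ltW ge_e] := leP (p * (X * D)) (e * a).
  apply: (@le_trans _ _ (e * a `^ p)).
    by rewrite -(mulr_powRB1 a0 p0) [leRHS]mulrA ler_wpM2r ?powR_ge0.
  rewrite -[leLHS]addr0 lerD//.
    by rewrite ler_wpM2l ?(ltW e0)// lerDl powR_ge0.
  by rewrite !mulr_ge0 ?powR_ge0// ltW.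
apply: (@le_trans _ _ (p * (p / e) `^ (p - 1) * (X * D) `^ p)); last first.
  by rewrite lerDr mulr_ge0 ?addr_ge0 ?powR_ge0// ltW.
rewrite -(mulr_powRB1 XD0 p0).
have -> : p * (p / e) `^ (p - 1) * (X * D * (X * D) `^ (p - 1)) =
   p * (X * D) * ((p / e) `^ (p - 1) * (X * D) `^ (p - 1)) by ring.
rewrite ler_wpM2l ?mulr_ge0 ?(ltW p0)//.
rewrite -powRM ?divr_ge0 ?(ltW p0) ?(ltW e0)//.
apply: ler_powRl; rewrite ?subr_ge0 ?(ltW p1)//.
by rewrite mulrAC ler_pdivlMr // mulrC.
Qed.

(** [exp y >= 1 + y] and [ln (1 + t) <= t]; for [s >= 0] the left side is just
    [1], so that no case distinction on the sign of [s] is needed later. *)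
Lemma powR_1D_ge s t : 0 <= t -> 1 - Num.max (- s) 0 * t <= (1 + t) `^ s.
Proof.
move=> t0; rewrite /powR gt_eqF; last by lra.
apply: le_trans (expR_ge1Dx _).
have l0 : 0 <= ln (1 + t) by apply: ln_ge0; lra.
have lt : ln (1 + t) <= t by apply: le_ln1Dx; lra.
rewrite lerD2l.
have [s0|s0] := leP (- s) 0; last by nra.
by rewrite mul0r oppr0 mulr_ge0//; lra.
Qed.

End real_inequalities.

(** * Sums of nonnegative functions *)

Section sums.
Variables (R : realType) (T : choiceType).
Implicit Types (f g : T -> R).

(** The sum lives in the extended reals so that monotonicity, additivity and
    reindexing hold without summability conditions. *)
Definition tsum f : \bar R := \esum_(x in [set: T]) (f x)%:E.

Local Notation "\tsum_ ( x ) F" := (tsum (fun x => F%R))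
  (at level 41, F at level 41, format "\tsum_ ( x )  F").

Lemma tsum_ge0 f : (forall x, 0 <= f x) -> (0 <= tsum f)%E.
Proof. by move=> f0; apply: esum_ge0 => x _; rewrite lee_fin. Qed.

Lemma le_tsum f g : (forall x, f x <= g x) -> (tsum f <= tsum g)%E.
Proof. by move=> fg; apply: le_esum => x _; rewrite lee_fin. Qed.

Lemma eq_tsum f g : (forall x, f x = g x) -> tsum f = tsum g.
Proof. by move=> fg; apply: eq_esum => x _; rewrite fg. Qed.

Lemma tsum0 : tsum (fun=> 0) = 0%E.
Proof. by apply: esum1. Qed.

Lemma tsumD f g : (forall x, 0 <= f x) -> (forall x, 0 <= g x) ->
  \tsum_(x) (f x + g x) = (tsum f + tsum g)%E.
Proof.
move=> f0 g0; rewrite /tsum -esumD; first by apply: eq_esum.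
- by move=> x _; rewrite lee_fin.
- by move=> x _; rewrite lee_fin.
Qed.

Lemma tsumZ c f : 0 <= c -> (forall x, 0 <= f x) ->
  \tsum_(x) (c * f x) = (c%:E * tsum f)%E.
Proof.
have half d g : 0 < d -> (forall x, 0 <= g x) ->
    (\tsum_(x) (d * g x) <= d%:E * tsum g)%E.
  move=> d0 g0; apply: ge_ereal_sup => _ [A [finA _] <-].
  have -> : \sum_(x \in A) (d * g x)%:E = (d%:E * \sum_(x \in A) (g x)%:E)%E.
    rewrite !fsumEFin// -EFinM; congr EFin.
    by rewrite !fsbig_finite//= mulr_sumr.
  rewrite lee_pmul2l//; apply: ereal_sup_ubound; exists A => //.
rewrite le_eqVlt => /predU1P[<- f0|c0 f0].
  by rewrite mul0e -tsum0; apply: eq_tsum => x; rewrite mul0r.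
apply/le_anti/andP; split; first exact: half.
have -> : tsum f = \tsum_(x) (c^-1 * (c * f x)).
  by apply: eq_tsum => x; rewrite mulKf ?gt_eqF.
apply: le_trans (lee_wpmul2l _ (half _ _ _ _)) _; rewrite ?lee_fin ?invr_gt0//.
- exact: ltW.
- by move=> x; rewrite mulr_ge0// ltW.
by rewrite muleA -EFinM divff ?gt_eqF// mul1e.
Qed.

Lemma le_tsumZ c f g : 0 <= c -> (forall x, 0 <= g x) ->
  (forall x, f x <= c * g x) -> (tsum f <= c%:E * tsum g)%E.
Proof. by move=> c0 g0 fg; rewrite -tsumZ//; exact: le_tsum. Qed.

Lemma tsum_sum (I : choiceType) (s : seq I) (f : I -> T -> R) :
    (forall i x, 0 <= f i x) ->
  \tsum_(x) (\sum_(i <- s) f i x) = (\sum_(i <- s) tsum (f i))%E.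
Proof.
move=> f0; rewrite /tsum -esum_sum; last by move=> x i _ _; rewrite lee_fin.
by apply: eq_esum => x _; rewrite sumEFin.
Qed.

Lemma tsum_ge_term f x : (forall x, 0 <= f x) -> ((f x)%:E <= tsum f)%E.
Proof.
move=> f0; apply: ereal_sup_ubound; exists [set x] => //=.
by rewrite fsbig_set1.
Qed.

Lemma tsum_bij f (e : T -> T) : bijective e ->
  \tsum_(x) (f (e x)) = tsum f.
Proof.
move=> bij_e; rewrite /tsum [RHS](@reindex_esum _ _ _ setT setT e)//.
by rewrite setTT_bijective.
Qed.

Lemma tsum_inj_le (I : choiceType) (e : I -> T) f :
    (forall x, 0 <= f x) -> injective e ->
  (\esum_(i in [set: I]) (f (e i))%:E <= tsum f)%E.
Proof.
move=> f0 inje.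
rewrite -(@esum_image _ _ _ setT e (fun x => (f x)%:E)); last first.
  by move=> ? ? _ _; exact: inje.
rewrite esum_mkcond; apply: le_esum => x _.
by case: ifP; rewrite // lee_fin.
Qed.

Lemma tsum_fin_supp f (A : set T) : finite_set A ->
    (forall x, 0 <= f x) -> (forall x, ~ A x -> f x = 0) ->
  exists2 r : R, 0 <= r & tsum f = r%:E.
Proof.
move=> finA f0 fA.
have -> : tsum f = \esum_(x in A) (f x)%:E.
  rewrite [RHS]esum_mkcond; apply: eq_esum => x _.
  case: ifPn => //; rewrite notin_setE => nA.
  by rewrite fA.
rewrite esum_fset//; last by move=> i _; rewrite lee_fin.
rewrite fsumEFin//; exists (\sum_(i \in A) f i) => //.
by rewrite fsbig_finite//=; apply: sumr_ge0.
Qed.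

(** A finite partial sum close to the supremum leaves little outside. *)
Lemma tsum_tail f e : (forall x, 0 <= f x) -> (tsum f < +oo)%E -> 0 < e ->
  exists2 A : set T, finite_set A &
    (\tsum_(x) (if x \in A then 0 else f x) < e%:E)%E.
Proof.
move=> f0 fin e0.
have ffin : tsum f \is a fin_num by rewrite ge0_fin_numE// tsum_ge0.
have [_ [A [finA _] <-]] := ub_ereal_sup_adherent e0 ffin.
rewrite -[ereal_sup _]/(tsum f) => h; exists A => //.
have E : tsum f = (\tsum_(x) (if x \in A then f x else 0%R) +
    \tsum_(x) (if x \in A then 0%R else f x))%E.
  rewrite -tsumD; last 2 first.
  - by move=> x; case: ifP.
  - by move=> x; case: ifP.
  by apply: eq_tsum => x; case: ifP; rewrite (addr0, add0r).
have EA : \tsum_(x) (if x \in A then f x else 0%R) = \sum_(x \in A) (f x)%:E.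
  rewrite -esum_fset//; last by move=> i _; rewrite lee_fin.
  by rewrite esum_mkcond; apply: eq_esum => x _; case: ifP.
rewrite EA fsumEFin// in E; rewrite fsumEFin// in h.
move: E h; set a := \sum_(i \in A) f i.
set b := tsum (fun x => if x \in A then 0 else f x).
have b0 : (0 <= b)%E by apply: tsum_ge0 => x; case: ifP.
case: b b0 => [r|//|//] r0 ->; last by rewrite addey.
by rewrite -EFinD !lte_fin; lra.
Qed.

(** Fatou's lemma with an error term: a partial sum sees only finitely many of the
    errors [g n x], which are therefore required to vanish pointwise only.  In this
    form [powR_add_le] can be used in place of the continuity of powers. *)
Lemma tsum_fatou f (h g : nat -> T -> R) (c : \bar R) (n0 : nat) :
    (forall n x, 0 <= h n x) ->
    (forall n x, f x <= h n x + g n x) ->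
    (forall x e, 0 < e -> exists n1, forall n, (n1 <= n)%N -> g n x <= e) ->
    (forall n, (n0 <= n)%N -> (tsum (h n) <= c)%E) ->
  (tsum f <= c)%E.
Proof.
move=> h0 fhg gcv hc; apply: ge_ereal_sup => _ [A [finA _] <-].
rewrite fsumEFin// fsbig_finite//=; set s := finmap.enum_fset _.
have small : forall e, 0 < e -> exists n1, forall n, (n1 <= n)%N ->
    \sum_(x <- s) g n x <= e.
  elim: s => [|x s ih] e e0.
    by exists 0%N => n _; rewrite big_nil ltW.
  have e2 : 0 < e / 2 by rewrite divr_gt0.
  have [n1 H1] := gcv x _ e2; have [n2 H2] := ih _ e2.
  exists (maxn n1 n2) => n; rewrite geq_max => /andP[/H1 h1 /H2 h2].
  by rewrite big_cons (splitr e) lerD.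
have hs n : ((\sum_(x <- s) h n x)%:E <= tsum (h n))%E.
  apply: ereal_sup_ubound; exists A => //=.
  by rewrite fsumEFin// fsbig_finite.
apply/lee_addgt0Pr => e e0.
have [n1 /(_ (maxn n0 n1) (leq_maxr _ _)) H1] := small _ e0.
set n := maxn n0 n1 in H1.
apply: (@le_trans _ _ ((\sum_(x <- s) h n x)%:E + e%:E)%E); last first.
  rewrite leeD2r//; apply: le_trans (hs n) _.
  by apply: hc; exact: leq_maxl.
rewrite -EFinD lee_fin.
apply: le_trans (_ : \sum_(x <- s) (h n x + g n x) <= _).
  by apply: ler_sum => x _.
by rewrite big_split /= lerD2l.
Qed.

Lemma esum_fintype (I : finType) (f : I -> R) : (forall i, 0 <= f i) ->
  \esum_(i in [set: I]) (f i)%:E = (\sum_i f i)%:E.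
Proof.
move=> f0; have finI : finite_set [set: I] by exact: finite_finset.
rewrite esum_fset//; last by move=> i _; rewrite lee_fin.
rewrite fsumEFin//; congr EFin.
have -> : [set: I] = [set` enum I] by apply/seteqP; split=> // i _; rewrite /= mem_enum.
by rewrite -fsbig_seq ?enum_uniq// big_enum.
Qed.

End sums.

Notation "\tsum_ ( x ) F" := (tsum (fun x => F%R))
  (at level 41, F at level 41, format "\tsum_ ( x )  F").

(** * The lattice and its graph distance *)

Section lattice_geometry.
Variable N : nat.
Implicit Types (x y z : lattice N) (j : 'I_N * bool).

Definition l1 x : nat := (\sum_(i < N) `|x ord0 i|)%N.

Definition step j : lattice N :=
  if j.2 then delta_mx ord0 j.1 else - delta_mx ord0 j.1.

Lemma l1_eq0 x : (l1 x == 0%N) = (x == 0).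
Proof.
apply/eqP/eqP => [/eqP|->]; last first.
  by rewrite /l1 big1// => i _; rewrite mxE.
rewrite sum_nat_eq0 => /forallP h; apply/matrixP => i j.
by rewrite !ord1 mxE; apply/eqP; rewrite -absz_eq0; exact: h.
Qed.

Lemma l1D x y : (l1 (x + y)%R <= l1 x + l1 y)%N.
Proof.
rewrite /l1 -big_split /=; apply: leq_sum => i _; rewrite mxE.
by rewrite -lez_nat PoszD !abszE ler_normD.
Qed.

Lemma l1N x : l1 (- x) = l1 x.
Proof. by apply: eq_bigr => i _; rewrite mxE abszN. Qed.

Lemma step_coord (i : 'I_N) j :
  step j ord0 i = if i == j.1 then (if j.2 then 1 else -1) else 0.
Proof.
rewrite /step; case: j => [k []] /=; rewrite !mxE eqxx /=; first by case: eqP.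
by case: eqP.
Qed.

Lemma l1_step j : l1 (step j) = 1%N.
Proof.
rewrite /l1 (bigD1 j.1)//= big1 => [|i /negbTE ij].
  by rewrite step_coord eqxx addn0; case: j.2.
by rewrite step_coord ij.
Qed.

Lemma step_inj : injective step.
Proof.
move=> [i b] [i' b'] /matrixP /(_ ord0 i).
rewrite !step_coord eqxx /=.
by case: eqP => [<-|]; case: b; case: b'.
Qed.

Lemma l1_eq1 x : l1 x = 1%N -> exists j, x = step j.
Proof.
move=> /eqP/sum_nat_eq1[i [_ xi h]].
exists (i, 0 < x ord0 i); apply/matrixP => i0 k; rewrite !ord1 step_coord /=.
case: eqP => [->|/eqP ki].
  by move: (x ord0 i) xi => z zi; case: ifP => hz; lia.
by apply/eqP; rewrite -absz_eq0 h.
Qed.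

Lemma lattice_adjE x y : lattice_adj x y = (l1 (y - x) == 1%N).
Proof.
rewrite /lattice_adj.
have -> : \sum_(i < N) `|x ord0 i - y ord0 i| = (l1 (y - x))%:Z.
  rewrite /l1 (big_morph Posz PoszD (erefl _)); apply: eq_bigr => i _.
  by rewrite abszE !mxE distrC.
by rewrite eqz_nat.
Qed.

Lemma lattice_adjP x y : reflect (exists j, y = x + step j) (lattice_adj x y).
Proof.
rewrite lattice_adjE; apply: (iffP eqP) => [/l1_eq1[j e]|[j ->]].
  by exists j; rewrite -e addrC subrK.
by rewrite addrC addKr l1_step.
Qed.

(** Move one step towards [0] in any nonzero coordinate. *)
Lemma l1_descend x n : l1 x = n.+1 -> exists j, l1 (x + step j) = n.
Proof.
move=> xn; have /existsP[i xi] : [exists i, x ord0 i != 0].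
  apply/existsPn => h; have : l1 x == 0%N; last by rewrite xn.
  rewrite l1_eq0; apply/eqP/matrixP => i j; rewrite !ord1 mxE.
  by apply/eqP; rewrite -[_ == _]negbK h.
exists (i, x ord0 i < 0); apply/eqP; rewrite -eqSS -xn; apply/eqP.
rewrite /l1 [in RHS](bigD1 i)//= (bigD1 i)//=.
rewrite -addSn; congr (_ + _)%N.
  rewrite mxE step_coord /= eqxx.
  by move: (x ord0 i) xi => z zi; case: ifP => hz; lia.
apply: eq_bigr => k ki; rewrite mxE step_coord /= (negbTE ki) addr0//.
Qed.

Lemma l1_step_le x j : (l1 (x + step j)%R <= (l1 x).+1)%N /\
  (l1 x <= (l1 (x + step j)%R).+1)%N.
Proof.
split; first by apply: leq_trans (l1D _ _) _; rewrite l1_step addn1.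
have := l1D (x + step j) (- step j).
by rewrite addrK l1N l1_step addn1.
Qed.

(** Induction along a geodesic from the origin. *)
Lemma lattice_ind (P : lattice N -> Prop) : P 0 ->
    (forall x j, l1 (x + step j) = (l1 x).+1 -> P x -> P (x + step j)) ->
  forall x, P x.
Proof.
move=> P0 PS x; have [n] := ubnP (l1 x); elim: n x => // n ih x.
case xn : (l1 x) => [|m].
  by move=> _; have /eqP := xn; rewrite l1_eq0 => /eqP ->.
move=> mn; have [j xj] := l1_descend xn.
have e : x = (x + step j) + step (j.1, ~~ j.2).
  rewrite -addrA; suff -> : step j + step (j.1, ~~ j.2) = 0 by rewrite addr0.
  by rewrite /step; case: j.2 => /=; rewrite (subrr, addNr).
rewrite e; apply: PS; first by rewrite -e xn xj.
by apply: ih; rewrite xj.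
Qed.

Lemma walk_to0 x : exists s, [/\ path (@lattice_adj N) x s, last x s = 0 &
  size s = l1 x].
Proof.
move: x; apply: lattice_ind => [|x j e [s [ps ls ss]]].
  by exists [::]; split=> //; apply/esym/eqP; rewrite l1_eq0.
exists (x :: s); split => //=; last by rewrite ss e.
rewrite ps andbT lattice_adjE opprD addrA subrr sub0r l1N l1_step//.
Qed.

Lemma l1_walk x s : path (@lattice_adj N) x s -> last x s = 0 -> (l1 x <= size s)%N.
Proof.
elim: s x => [x _ /= ->|y s ih x /= /andP[xy /ih h] /h le].
  by rewrite leqn0 l1_eq0.
move: xy; rewrite lattice_adjE => /eqP xy.
have -> : x = y - (y - x) by rewrite opprB addrC subrK.
apply: leq_trans (l1D _ _) _; rewrite l1N xy addn1 ltnS//.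
Qed.

Lemma graph_dist0 (R : realType) x : graph_dist R x 0 = (l1 x)%:R.
Proof.
rewrite /graph_dist; set A := [set _ | _ in _].
have Al : lbound A (l1 x)%:R.
  by move=> _ [s [/= ps ls] <-]; rewrite ler_nat; exact: l1_walk.
have Ax : A (l1 x)%:R.
  by have [s [ps ls <-]] := walk_to0 x; exists s.
apply/le_anti/andP; split.
  by apply: ge_inf => //; exists (l1 x)%:R.
by apply: lb_le_inf => //; exists (l1 x)%:R.
Qed.

End lattice_geometry.

(** * From norms to sums of powers *)

Section ereal_convergence.
Variable R : realType.
Implicit Types (X : \bar R) (e p : R).

Lemma poweR_inv_lt X p e : 0 < p -> 0 < e -> (0 <= X)%E ->
  (X `^ p^-1 < e%:E)%E = (X < (e `^ p)%:E)%E.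
Proof.
move=> p0 e0; case: X => [r|_|//]; last first.
  by rewrite poweRyr ?invr_eq0 ?gt_eqF.
rewrite lee_fin poweR_EFin !lte_fin => r0.
have eE : e = (e `^ p) `^ p^-1.
  by rewrite -powRrM divff ?gt_eqF// powRr1// ltW.
apply/idP/idP => h; last first.
  by rewrite eE; apply: gt0_ltr_powR; rewrite ?invr_gt0// nnegrE powR_ge0.
have -> : r = (r `^ p^-1) `^ p.
  by rewrite -powRrM mulVf ?gt_eqF// powRr1.
by apply: gt0_ltr_powR; rewrite // nnegrE ?powR_ge0// ltW.
Qed.

Lemma cvg_nneg_ereal0P (g : nat -> \bar R) : (forall n, 0 <= g n)%E ->
  (g n @[n --> \oo] --> 0%E) <->
  (forall e, 0 < e -> exists n0, forall n, (n0 <= n)%N -> (g n < e%:E)%E).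
Proof.
move=> g0; split=> [/fine_cvgP[gfin /cvgrPdist_lt gcv] e e0|h].
  have [n1 _ H1] := gfin; have [n2 _ H2] := gcv _ e0.
  exists (maxn n1 n2) => n; rewrite geq_max => /andP[/H1 fg /H2 /=].
  rewrite sub0r normrN ger0_norm ?fine_ge0// => lt.
  by rewrite -(fineK fg) lte_fin.
apply/fine_cvgP; split.
  have [n0 H] := h 1 ltr01; exists n0 => // n /H lt.
  by rewrite ge0_fin_numE// (lt_le_trans lt)// leey.
apply/cvgrPdist_lt => e e0; have [n0 H] := h e e0; exists n0 => // n /H lt.
rewrite /= sub0r normrN ger0_norm ?fine_ge0//.
rewrite -lte_fin fineK// ge0_fin_numE//.
by rewrite (lt_le_trans lt)// leey.
Qed.

Variables (T : Type) (p : R) (nrm m : (T -> R) -> \bar R).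
Hypotheses (p0 : 0 < p) (m0 : forall u, (0 <= m u)%E)
  (nrmE : forall u, nrm u = (m u `^ p^-1)%E).

(** Convergence and the Cauchy property for a norm [m^(1/p)] only refer to small
    values, so they can be tested on [m]. *)
Lemma norm_cvgP f u : norm_cvg nrm f u <->
  (forall e, 0 < e -> exists n0, forall n, (n0 <= n)%N -> (m (f n \- u)%R < e%:E)%E).
Proof.
rewrite /norm_cvg cvg_nneg_ereal0P; last by move=> n; rewrite nrmE poweR_ge0.
split=> h e e0.
  have [n0 H] := h (e `^ p^-1) (powR_gt0 _ e0); exists n0 => n /H.
  rewrite nrmE poweR_inv_lt// ?powR_gt0//.
  by rewrite -powRrM mulVf ?gt_eqF// powRr1// ltW.
have [n0 H] := h (e `^ p) (powR_gt0 _ e0); exists n0 => n /H.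
by rewrite nrmE poweR_inv_lt.
Qed.

Lemma norm_cauchyP f : norm_cauchy nrm f <->
  (forall e, 0 < e -> exists n0, forall k n, (n0 <= k)%N -> (n0 <= n)%N ->
     (m (f k \- f n)%R < e%:E)%E).
Proof.
split=> h e e0.
  have [n0 H] := h (e `^ p^-1) (powR_gt0 _ e0); exists n0 => k n hk hn.
  move: (H k n hk hn); rewrite nrmE poweR_inv_lt// ?powR_gt0//.
  by rewrite -powRrM mulVf ?gt_eqF// powRr1// ltW.
have [n0 H] := h (e `^ p) (powR_gt0 _ e0); exists n0 => k n hk hn.
by move: (H k n hk hn); rewrite nrmE poweR_inv_lt.
Qed.

Lemma norm_lty u : (nrm u < +oo)%E = (m u < +oo)%E.
Proof.
rewrite nrmE; apply/idP/idP; last exact: poweR_lty.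
by apply: lty_poweRy; rewrite invr_eq0 gt_eqF.
Qed.

Lemma norm_eq0 u : nrm u = 0%E -> m u = 0%E.
Proof. by rewrite nrmE; apply: poweR_eq0_eq0. Qed.

End ereal_convergence.

Section modulars.
Variables (R : realType) (N : nat).
Implicit Types (u v : lattice N -> R) (x y z : lattice N).

Definition wt x : R := 1 + (l1 x)%:R.

Lemma wt_ge1 x : 1 <= wt x. Proof. by rewrite lerDl. Qed.

Lemma wt_gt0 x : 0 < wt x. Proof. by rewrite (lt_le_trans ltr01) ?wt_ge1. Qed.

Lemma wt_ge0 x : 0 <= wt x. Proof. by rewrite ltW ?wt_gt0. Qed.

Definition grad p u x : R :=
  \sum_(j : 'I_N * bool) `|u (x + step j) - u x| `^ p.

Lemma grad_ge0 p u x : 0 <= grad p u x.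
Proof. by apply: sumr_ge0 => j _; exact: powR_ge0. Qed.

Lemma grad_ge p u x j : `|u (x + step j) - u x| `^ p <= grad p u x.
Proof.
rewrite /grad (bigD1 j)//= lerDl; apply: sumr_ge0 => i _; exact: powR_ge0.
Qed.

(** The norms without their outer roots ([D_normE], [lb_normE]).  The weight exponent
    is an independent argument because Hardy's inequality has the exponent
    [a p - p] on its left side. *)
Definition energy alpha p u : \bar R := \tsum_(x) (wt x `^ alpha * grad p u x).

Definition mass beta q u : \bar R := \tsum_(x) (wt x `^ beta * `|u x| `^ q).

Lemma energy_term_ge0 a p u x : 0 <= wt x `^ a * grad p u x.
Proof. by rewrite mulr_ge0 ?powR_ge0 ?grad_ge0. Qed.

Lemma mass_term_ge0 b q u x : 0 <= wt x `^ b * `|u x| `^ q.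
Proof. by rewrite mulr_ge0 ?powR_ge0. Qed.

Lemma energy_ge0 a p u : (0 <= energy a p u)%E.
Proof. by apply: tsum_ge0 => x; exact: energy_term_ge0. Qed.

Lemma mass_ge0 b q u : (0 <= mass b q u)%E.
Proof. by apply: tsum_ge0 => x; exact: mass_term_ge0. Qed.

Lemma lb_normE b q u : lb_norm b q u = (mass (b * q) q u `^ q^-1)%E.
Proof.
by congr poweR; apply: eq_esum => x _; rewrite /lattice_weight graph_dist0.
Qed.

Lemma D_normE a p u : D_norm a p u = (energy (a * p) p u `^ p^-1)%E.
Proof.
congr poweR; apply: eq_esum => x _.
rewrite (@reindex_esum _ _ _ [set: 'I_N * bool] _ (fun j => x + step j)).
  rewrite esum_fintype; last by move=> j; rewrite mulr_ge0 ?powR_ge0.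
  by rewrite /lattice_weight graph_dist0 /grad mulr_sumr.
split.
- by move=> j _; apply/lattice_adjP; exists j.
- by move=> i j _ _ /addrI/step_inj.
- by move=> y /lattice_adjP[j ->]; exists j.
Qed.

Lemma finite_support_grad u A : finite_set A -> (forall x, ~ A x -> u x = 0) ->
  exists2 B : set (lattice N), finite_set B &
    forall x, ~ B x -> u x = 0 /\ forall j, u (x + step j) = 0.
Proof.
move=> finA uA.
exists (A `|` \bigcup_(j in [set: 'I_N * bool]) [set y - step j | y in A]).
  rewrite finite_setU; split=> //; apply: bigcup_finite => [|j _].
    exact: finite_finset.
  exact: finite_image.
move=> x nB; split; first by apply: uA => Ax; apply: nB; left.
move=> j; apply: uA => Ax; apply: nB; right.
by exists j => //; exists (x + step j) => //; rewrite addrK.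
Qed.

Lemma energy_fin a p u : 0 < p -> finitely_supported u ->
  exists2 r : R, 0 <= r & energy a p u = r%:E.
Proof.
move=> p0 fu; have [|B finB uB] := @finite_support_grad u _ fu.
  by move=> x /negP; rewrite negbK => /eqP.
apply: tsum_fin_supp finB (energy_term_ge0 _ _ _) _ => x /uB[ux uj].
rewrite /grad big1 ?mulr0// => j _.
by rewrite ux uj subrr normr0 powR0// gt_eqF.
Qed.

Lemma mass_fin b q u : 0 < q -> finitely_supported u ->
  exists2 r : R, 0 <= r & mass b q u = r%:E.
Proof.
move=> q0 fu; apply: tsum_fin_supp fu (mass_term_ge0 _ _ _) _ => x.
by move/negP; rewrite negbK => /eqP ->; rewrite normr0 powR0 ?mulr0// gt_eqF.
Qed.

End modulars.

(** * Differences along walks and a Poincare inequality *)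

Section translations.
Variables (R : realType) (N : nat).
Implicit Types (u v : lattice N -> R) (x y z : lattice N) (X : lattice N -> bool).

Lemma iter_adde n (c : \bar R) : (0 <= c)%E ->
  iter n (+%E c) 0%E = (n%:R%:E * c)%E.
Proof.
move=> c0; elim: n => [|n ih]; first by rewrite mul0e.
by rewrite iterS ih -natr1 EFinD ge0_muleDl ?lee_fin// mul1e addeC.
Qed.

Lemma tsum_shift (f : lattice N -> R) z : \tsum_(x) f (x + z) = tsum f.
Proof.
by apply: tsum_bij; exists (fun x => x - z) => x; rewrite (addrK, subrK).
Qed.

(** The walk [s] and its directions do not depend on [x] or [v]; this is what
    allows summing over [x] in [translation_energy]. *)
Lemma walk_telescope y : exists s : seq (lattice N * ('I_N * bool)),
  [/\ size s = l1 y, (forall zj, zj \in s -> (l1 zj.1 <= l1 y)%N) &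
   forall v x, `|v (x + y) - v x| <=
     \sum_(zj <- s) `|v (x + zj.1 + step zj.2) - v (x + zj.1)|].
Proof.
move: y; apply: lattice_ind => [|y j e [s [ss sl sv]]].
  exists [::]; split=> //; first by apply/esym/eqP; rewrite l1_eq0.
  by move=> v x; rewrite big_nil addr0 subrr normr0.
exists ((y, j) :: s); split=> /=.
- by rewrite ss e.
- move=> zj; rewrite inE => /predU1P[->|/sl]; rewrite e//=.
  exact: leqW.
- move=> v x; rewrite big_cons /=.
  have -> : v (x + (y + step j)) - v x =
     (v (x + y + step j) - v (x + y)) + (v (x + y) - v x).
    by rewrite addrA subrKA.
  by apply: le_trans (ler_normD _ _) _; rewrite lerD2l.
Qed.

(** Jensen along the walk costs [m^(p-1)] for a walk of [m] steps, and after
    summation over [x] each of the [m] steps contributes a shifted energy. *)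
Lemma translation_energy p v y X X' : 1 < p ->
    (forall x z, X x -> (l1 z <= l1 y)%N -> X' (x + z)) ->
  (\tsum_(x) ((X x)%:R * `|v (x + y) - v x| `^ p) <=
   ((l1 y)%:R `^ p)%:E * \tsum_(x) ((X' x)%:R * grad p v x))%E.
Proof.
move=> p1 XX'; have p0 : 0 < p by lra.
have [s [ss sl sv]] := walk_telescope y.
set m : R := (l1 y)%:R.
have t0 x : 0 <= (X' x)%:R * grad p v x by rewrite mulr_ge0 ?grad_ge0.
apply: (@le_trans _ _ (\tsum_(x) (m `^ (p - 1) *
    \sum_(z <- map fst s) ((X' (x + z))%:R * grad p v (x + z))))); last first.
  rewrite tsumZ ?powR_ge0//; last by move=> x; apply: sumr_ge0.
  rewrite tsum_sum//.
  rewrite (eq_bigr (fun=> \tsum_(x) ((X' x)%:R * grad p v x))); last first.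
    by move=> z _; exact: (tsum_shift (fun x => (X' x)%:R * grad p v x)).
  rewrite big_const_seq count_predT size_map ss iter_adde ?tsum_ge0// -/m.
  rewrite muleA -EFinM; apply: lee_wpmul2r; first exact: tsum_ge0.
  by rewrite lee_fin mulrC mulr_powRB1.
apply: le_tsum => x; case Xx : (X x); last first.
  by rewrite mul0r mulr_ge0 ?powR_ge0//; apply: sumr_ge0.
rewrite mul1r.
apply: (@le_trans _ _ (m `^ (p - 1) *
  \sum_(zj <- s) `|v (x + zj.1 + step zj.2) - v (x + zj.1)| `^ p)).
  apply: le_trans (ler_powRl (ltW p0) (normr_ge0 _) (sv v x)) _.
  by rewrite /m -ss; exact: powR_sum_le.
rewrite ler_wpM2l ?powR_ge0// big_map big_seq [leRHS]big_seq.
apply: ler_sum => zj zs; rewrite XX' ?mul1r ?grad_ge//.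
exact: sl.
Qed.

Definition box_point r (h : {ffun 'I_N -> 'I_r}) : lattice N :=
  \row_i (h i : nat)%:Z.

Lemma box_point_inj r : injective (@box_point r).
Proof.
move=> h k /matrixP e; apply/ffunP => i; apply/val_inj.
by have := e ord0 i; rewrite !mxE => -[].
Qed.

Lemma l1_box_point r (h : {ffun 'I_N -> 'I_r}) : (l1 (box_point h) <= N * r)%N.
Proof.
apply: (@leq_trans (\sum_(i < N) r)%N); last by rewrite sum_nat_const card_ord.
by apply: leq_sum => i _; rewrite mxE /= ltnW.
Qed.

Lemma card_box r : #|{ffun 'I_N -> 'I_r}| = (r ^ N)%N.
Proof. by rewrite card_ffun !card_ord. Qed.

(** If at least half of the translates of [x] by a cube of side [r] are zeros of
    [v], then [|v x|^p] is at most twice the average of [|v (x + h) - v x|^p] over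
    the cube. *)
Lemma local_poincare p v X X' r : 1 < p -> (0 < r)%N ->
    (forall x, X x -> v x != 0 ->
      (2 * #|[pred h : {ffun 'I_N -> 'I_r} | v (x + box_point h)%R != 0%R]| <= r ^ N)%N) ->
    (forall x z, X x -> (l1 z <= N * r)%N -> X' (x + z)) ->
  (\tsum_(x) ((X x)%:R * `|v x| `^ p) <=
   (2 * (N * r)%:R `^ p)%:E * \tsum_(x) ((X' x)%:R * grad p v x))%E.
Proof.
move=> p1 r0 half XX'; have p0 : 0 < p by lra.
set E := \tsum_(x) ((X' x)%:R * grad p v x).
have E0 : (0 <= E)%E by apply: tsum_ge0 => x; rewrite mulr_ge0 ?grad_ge0.
have rN0 : 0 < (r ^ N)%:R :> R by rewrite ltr0n expn_gt0 r0.
rewrite -(@lee_pmul2l _ (r ^ N)%:R%:E)//.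
rewrite -tsumZ; [|exact: ltW|by move=> x; rewrite mulr_ge0 ?powR_ge0].
have pt x : (r ^ N)%:R * ((X x)%:R * `|v x| `^ p) <=
    2 * \sum_(h : {ffun 'I_N -> 'I_r}) ((X x)%:R * `|v (x + box_point h) - v x| `^ p).
  case Xx : (X x); last first.
    rewrite mul0r mulr0 mulr_ge0//; apply: sumr_ge0 => h _.
    by rewrite mul0r.
  rewrite mul1r; have [->|vx] := eqVneq (v x) 0.
    rewrite normr0 powR0 ?gt_eqF// mulr0 mulr_ge0//; apply: sumr_ge0 => h _.
    by rewrite mul1r powR_ge0.
  have := half x Xx vx; set H := [pred h | _] => hH.
  have lH : (r ^ N)%:R * `|v x| `^ p <= 2 * (#|[predC H]|%:R * `|v x| `^ p).
    rewrite mulrA ler_wpM2r ?powR_ge0// -natrM ler_nat.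
    have e : (#|H| + #|[predC H]| = r ^ N)%N by rewrite cardC card_box.
    by rewrite -e in hH *; move: #|H| #|[predC H]| hH => i k; lia.
  apply: le_trans lH _; rewrite ler_wpM2l// -sumr_const mulr_suml [leLHS]big_mkcond.
  apply: ler_sum => h _; rewrite !mul1r; case: ifP => [|_]; last exact: powR_ge0.
  by rewrite !inE negbK => /eqP ->; rewrite sub0r normrN.
apply: le_trans (le_tsum pt) _.
rewrite tsumZ//; last first.
  by move=> x; apply: sumr_ge0 => h _; rewrite mulr_ge0 ?powR_ge0.
rewrite tsum_sum; last by move=> h x; rewrite mulr_ge0 ?powR_ge0.
rewrite EFinM -!muleA muleCA; apply: lee_wpmul2l => //.
apply: (@le_trans _ _ (\sum_(h : {ffun 'I_N -> 'I_r}) (((N * r)%:R `^ p)%:E * E))%E).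
  apply: lee_sum => h _.
  apply: le_trans (@translation_energy p v (box_point h) X X' p1 _) _.
    move=> x z Xx zl; apply: XX' => //.
    exact: leq_trans zl (l1_box_point h).
  apply: lee_wpmul2r => //; rewrite lee_fin ler_powRl ?ler_nat ?l1_box_point//.
  exact: ltW.
by rewrite big_const iter_adde ?card_box// mule_ge0// lee_fin powR_ge0.
Qed.

End translations.

(** * Hardy's inequality *)

Section hardy.
Variables (R : realType) (N : nat).
Implicit Types (u v : lattice N -> R) (x y z : lattice N) (i : 'I_N).

Let up i : lattice N := step (i, true).
Let dn i : lattice N := step (i, false).

Let dnK i x : x + dn i + up i = x.
Proof. by rewrite -addrA /dn /up /step /= addNr addr0. Qed.

(** Summation by parts, [sum g div F = sum F (g - g shifted)].  As [F] is signed
    and [tsum] is meant for nonnegative terms, [F] is split into positive and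
    negative parts, the negative terms are moved to the other side, and the
    common sum [Y], finite because [g] has finite support, is cancelled. *)
Lemma sum_by_parts (F : 'I_N -> lattice N -> R) (g h : lattice N -> R)
    (A : set (lattice N)) : finite_set A ->
    (forall x, 0 <= g x) -> (forall x, ~ A x -> g x = 0) ->
    (forall x, 0 <= h x) ->
    (forall x, h x <= g x * \sum_i (F i x - F i (x + step (i, false)))) ->
  (tsum h <= \tsum_(x) \sum_i (`|F i x| * `|g x - g (x + step (i, true))|))%E.
Proof.
move=> finA g0 gA h0 hF.
pose P i x := Num.max (F i x) 0; pose M i x := Num.max (- F i x) 0.
have P0 i x : 0 <= P i x by rewrite le_max lexx orbT.
have M0 i x : 0 <= M i x by rewrite le_max lexx orbT.
have PM i x : F i x = P i x - M i x /\ `|F i x| = P i x + M i x.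
  rewrite /P /M; case: (boolP (0 <= F i x)) => [Fx|].
    by rewrite max_l// max_r ?oppr_le0// subr0 addr0 ger0_norm.
  rewrite -ltNge => Fx; rewrite max_r ?(ltW Fx)// max_l ?oppr_ge0 ?(ltW Fx)// sub0r opprK add0r.
  by rewrite ltr0_norm.
pose Y x := \sum_i (g x * M i x + g x * P i (x + dn i)).
pose Z x := \sum_i (g x * P i x + g x * M i (x + dn i)).
pose Y' x := \sum_i (g x * M i x + g (x + up i) * P i x).
pose D x := \sum_i (`|F i x| * `|g x - g (x + up i)|).
have shift (Q S : 'I_N -> lattice N -> R) : (forall i x, 0 <= Q i x) ->
    (forall i x, 0 <= S i x) ->
    \tsum_(x) \sum_i (g x * Q i x + g x * S i (x + dn i)) =
    \tsum_(x) \sum_i (g x * Q i x + g (x + up i) * S i x).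
  move=> Q0 S0.
  rewrite !tsum_sum; last 2 first.
  - by move=> i x; rewrite addr_ge0// mulr_ge0.
  - by move=> i x; rewrite addr_ge0// mulr_ge0.
  apply: eq_bigr => i _; rewrite !tsumD; try by move=> x; rewrite mulr_ge0.
  congr (_ + _)%E.
  rewrite -[RHS](tsum_shift (fun x => g (x + up i) * S i x) (dn i)).
  by apply: eq_tsum => x; rewrite dnK.
have Y0 x : 0 <= Y x by apply: sumr_ge0 => i _; rewrite addr_ge0// mulr_ge0.
have D0 x : 0 <= D x by apply: sumr_ge0 => i _; rewrite mulr_ge0.
have Y'0 x : 0 <= Y' x by apply: sumr_ge0 => i _; rewrite addr_ge0// mulr_ge0.
have YA x : ~ A x -> Y x = 0.
  by move=> /gA gx; rewrite /Y big1// => i _; rewrite gx !mul0r addr0.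
have [r r0 Yr] := tsum_fin_supp finA Y0 YA.
have h1 : (tsum h + tsum Y <= tsum Z)%E.
  rewrite -tsumD//; apply: le_tsum => x.
  rewrite -lerBrDr; apply: le_trans (hF x) _.
  rewrite /Z /Y -sumrB mulr_sumr; apply: ler_sum => i _.
  have [-> _] := PM i x; have [-> _] := PM i (x + dn i).
  by rewrite le_eqVlt; apply/orP; left; apply/eqP; ring.
have h2 : (tsum Z <= tsum Y + tsum D)%E.
  rewrite /Z /Y !shift// -tsumD//; apply: le_tsum => x.
  rewrite /D -big_split /=; apply: ler_sum => i _.
  have [_ ->] := PM i x.
  set a := g x; set b := g _; set m := M i x; set q := P i x.
  have m0 : 0 <= m by exact: M0.
  have q0 : 0 <= q by exact: P0.
  by case: (leP 0 (a - b)) => ab; [rewrite ger0_norm//|rewrite ltr0_norm//]; nra.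
by have := le_trans h1 h2; rewrite Yr addeC leeD2lE.
Qed.

(** The discrete analogue of the vector field [x |x|^s].  The half-integer shift
    makes the flow antisymmetric under [x i -> - x i], so it is directed outward on
    both sides of the hyperplane [x i = 0], and the constant [K] tames the
    discretisation error near the origin. *)
Definition hardy_flux (K s : R) i x : R :=
  ((x ord0 i)%:~R + 2^-1) * (K + (minn (l1 x) (l1 (x + up i)))%:R) `^ s.

Lemma l1_step_coord j x :
  (l1 (x + step j)%R + `|x ord0 j.1| =
   l1 x + `|(x ord0 j.1 + if j.2 then 1 else -1)%R|)%N.
Proof.
rewrite /l1 (bigD1 j.1)//= [in RHS](bigD1 j.1)//= !mxE step_coord eqxx.
rewrite (eq_bigr (fun i => `|x ord0 i|%N)).
  by rewrite -addnA addnC; congr (_ + _)%N; rewrite addnC.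
by move=> i /negbTE ij; rewrite mxE step_coord ij addr0.
Qed.

(** Outflow minus inflow in direction [i] depends on [x i] only through its
    absolute value [m]; a point with [m = 0] has two outgoing edges. *)
Lemma hardy_flux_diff K s i x (m := `|x ord0 i|%N) :
  hardy_flux K s i x - hardy_flux K s i (x + dn i) =
  if m == 0%N then (K + (l1 x)%:R) `^ s
  else (m%:R + 2^-1) * (K + (l1 x)%:R) `^ s
       - (m%:R - 2^-1) * (K + (l1 x).-1%:R) `^ s.
Proof.
rewrite /hardy_flux dnK.
have := l1_step_coord (i, true) x; have := l1_step_coord (i, false) x.
rewrite -/(up i) -/(dn i) mxE [dn i _ _]step_coord /= eqxx.
rewrite {}/m; move: (x ord0 i) => z; rewrite intrD.
case: (ltgtP z 0) => hz.
- have [m ->] : exists m : nat, z = - m.+1%:Z by exists (`|z|.-1)%N; lia.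
  rewrite abszN /= => h1 h2.
  rewrite (_ : minn (l1 x) _ = (l1 x).-1); last by lia.
  rewrite (_ : minn (l1 (x + dn i)%R) _ = l1 x); last by lia.
  rewrite !mulrNz -!pmulrn; by move: m.+1%:R => b; field.
- have [m ->] : exists m : nat, z = m.+1%:Z by exists (`|z|.-1)%N; lia.
  rewrite /= => h1 h2.
  rewrite (_ : minn (l1 x) _ = l1 x); last by lia.
  rewrite (_ : minn (l1 (x + dn i)%R) _ = (l1 x).-1); last by lia.
  rewrite !mulrNz -!pmulrn; by move: m.+1%:R => b; field.
- rewrite hz /= => h1 h2.
  rewrite (_ : minn (l1 x) _ = l1 x); last by lia.
  rewrite (_ : minn (l1 (x + dn i)%R) _ = l1 x); last by lia.
  by field.
Qed.

(** At distance [d + 1], with [t = 1 / (K + d)], the direction [i] contributes at least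
    [(1 - sg t) psi - m sg t psi], where [psi] is the weight of the previous sphere.
    The sum over [i] is [(N - sg t (d + 1) - sg N t) psi], where [t (d + 1) <= 1] and
    the last term is as small as desired for [K] large; what remains is
    [N - sg > 0], which is the hypothesis on [s]. *)
Lemma hardy_div_ge s : (0 < N)%N -> 0 < N%:R + s -> exists K c : R, [/\ 1 <= K, 0 < c &
  forall x, c * (K + (l1 x)%:R) `^ s <=
    \sum_i (hardy_flux K s i x - hardy_flux K s i (x + dn i))].
Proof.
move=> N0 Ns; set sg := Num.max (- s) 0.
have sg0 : 0 <= sg by rewrite le_max lexx orbT.
have {}N0 : 0 < N%:R :> R by rewrite ltr0n.
have sN : sg < N%:R.
  rewrite /sg; case: (leP (- s) 0) => _ //.
  by rewrite -subr_gt0 opprK.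
pose g := N%:R - sg; have g0 : 0 < g by rewrite subr_gt0.
pose K := 1 + 2 * sg * N%:R / g.
have K1 : 1 <= K by rewrite lerDl divr_ge0 ?(ltW g0)// !mulr_ge0// ltW.
pose c := g / 2 * (2 `^ `|s|)^-1.
have p2 : 1 <= 2 `^ `|s| 
  by have := @ler_powR R 2 (ler1n _ 2) _ _ (normr_ge0 s); rewrite powRr0.
have c0 : 0 < c by rewrite mulr_gt0 ?divr_gt0// invr_gt0 powR_gt0.
exists K, c; split=> // x.
under eq_bigr do rewrite hardy_flux_diff.
case dE : (l1 x) => [|d].
  have /eqP x0 : x == 0 by rewrite -l1_eq0 dE.
  rewrite (eq_bigr (fun=> (K + 0%:R) `^ s)); last by move=> i _; rewrite x0 mxE.
  rewrite sumr_const card_ord -[leRHS]mulr_natl ler_wpM2r ?powR_ge0//.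
  apply: (@le_trans _ _ (g / 2)).
    by rewrite ler_piMr ?divr_ge0 ?(ltW g0)// invf_le1// powR_gt0.
  by rewrite /g; lra.
set phi := (K + d.+1%:R) `^ s; set psi := (K + d.+1.-1%:R) `^ s.
pose t := (K + d%:R)^-1.
have d0 : 0 <= d%:R :> R by [].
have Kd : 0 < K + d%:R by lra.
have t0 : 0 < t by rewrite invr_gt0.
have psi0 : 0 <= psi by exact: powR_ge0.
have phiE : (1 - sg * t) * psi <= phi.
  rewrite /phi (_ : K + d.+1%:R = (1 + t) * (K + d%:R)); last first.
    by rewrite /t -natr1; field; rewrite gt_eqF.
  rewrite powRM ?(ltW Kd)//; last by rewrite addr_ge0// ltW.
  by rewrite ler_wpM2r//; apply: powR_1D_ge; exact: ltW.
have step i : - (`|x ord0 i|%N%:R * (sg * t * psi)) + (1 - sg * t) * psi <=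
   (if `|x ord0 i|%N == 0%N then phi else
    (`|x ord0 i|%N%:R + 2^-1) * phi - (`|x ord0 i|%N%:R - 2^-1) * psi).
  have := mulr_ge0 (mulr_ge0 sg0 (ltW t0)) psi0.
  case: eqP => [->|_ h]; first by rewrite mul0r oppr0 add0r.
  set m : R := (_)%:R; have m0 : 0 <= m by [].
  by nra.
apply: le_trans (ler_sum _ (fun i _ => step i)).
rewrite big_split /= sumr_const card_ord sumrN -mulr_suml -natr_sum.
rewrite -/(l1 x) dE -[_ * psi *+ N]mulr_natl.
have psiphi : phi <= 2 `^ `|s| * psi.
  have dS : d.+1%:R = d%:R + 1 :> R by rewrite natr1.
  by rewrite /phi /psi dS /=; apply: powR_comparable; lra.
apply: (@le_trans _ _ (g / 2 * psi)).
  rewrite /c -[leLHS]mulrA ler_wpM2l ?divr_ge0 ?(ltW g0)//.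
  by rewrite ler_pdivrMl ?powR_gt0.
rewrite (_ : - (d.+1%:R * (sg * t * psi)) + N%:R * ((1 - sg * t) * psi) =
  (N%:R - sg * (t * d.+1%:R) - sg * N%:R * t) * psi); last by ring.
rewrite ler_wpM2r//.
have td : t * d.+1%:R <= 1 by rewrite ler_pdivrMl// -natr1; lra.
have tN : sg * N%:R * t <= g / 2.
  have : sg * N%:R <= g / 2 * (K + d%:R).
    have -> : sg * N%:R = g / 2 * (2 * sg * N%:R / g) by field; rewrite gt_eqF.
    by rewrite ler_wpM2l ?divr_ge0 ?(ltW g0)// /K; lra.
  by rewrite /t ler_pdivrMr.
have h : sg * (t * d.+1%:R) <= sg by rewrite ler_piMr.
by rewrite /g in tN *; lra.
Qed.

(** Sum [|u|^p] against the divergence by parts.  [powR_diff_young] with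
    [X = wt x] bounds the edge terms by [e] times the left side, which is
    absorbed, plus a multiple of the energy. *)
Theorem hardy p s : 1 < p -> (0 < N)%N -> 0 < N%:R + s ->
  exists2 C : R, 0 <= C & forall u, finitely_supported u ->
    (mass s p u <= C%:E * energy (s + p) p u)%E.
Proof.
move=> p1 N0 Ns; have p0 : 0 < p by lra.
have [K [c [K1 c0 hdiv]]] := hardy_div_ge N0 Ns.
pose C1 : R := 2 `^ `|s|; have C10 : 0 < C1 by exact: powR_gt0.
have C11 : 1 <= C1.
  by rewrite /C1 -[leLHS](powRr0 2) ler_powR// ler1n.
have NR : 0 < N%:R :> R by rewrite ltr0n.
pose d := N%:R * C1 * (1 + C1); have d0 : 0 < d by rewrite !mulr_gt0// addr_gt0.
pose e := c / 2 / d; have e0 : 0 < e by rewrite !divr_gt0.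
have [Ce Ce0 young] := powR_diff_young p1 e0.
pose KK := K `^ `|s|; have KK0 : 0 <= KK by exact: powR_ge0.
exists (2 / c * (N%:R * C1 * Ce) * (KK * KK)).
  by rewrite !mulr_ge0// ?(ltW NR) ?(ltW C10) ?invr_ge0// ltW.
move=> u fu.
pose ph x := (K + (l1 x)%:R) `^ s; pose g x := `|u x| `^ p.
have ph0 x : 0 <= ph x by exact: powR_ge0.
have g0 x : 0 <= g x by exact: powR_ge0.
have l10 x : 0 <= (l1 x)%:R :> R by [].
have gA x : ~ [set x | u x != 0] x -> g x = 0.
  by move/negP; rewrite negbK /g => /eqP ->; rewrite normr0 powR0// gt_eqF.
have phup i x : ph x <= C1 * ph (x + up i).
  have [h1 h2] := l1_step_le x (i, true).
  by apply: powR_shift_near; rewrite ?natr1 ?ler_nat.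
have flux i x : `|hardy_flux K s i x| <= C1 * ph x * wt R x.
  rewrite normrM mulrC ler_pM//.
    rewrite ger0_norm ?powR_ge0//; case: (leqP (l1 x) (l1 (x + up i))) => h.
      by rewrite -/(ph x) ler_peMl.
    have [h1 h2] := l1_step_le x (i, true).
    by apply: powR_shift_near; rewrite ?natr1 ?ler_nat.
  apply: le_trans (ler_normD _ _) _; rewrite addrC ger0_norm//.
  rewrite lerD ?invf_le1//; first by rewrite ler1n.
  rewrite -intr_norm -abszE -pmulrn ler_nat /l1 (bigD1 i)//= leq_addr//.
have [T T0 TE] : exists2 T : R, 0 <= T & \tsum_(x) (ph x * g x) = T%:E.
  apply: (tsum_fin_supp fu) => [x|x /gA ->]; [exact: mulr_ge0|exact: mulr0].
pose G x := ph x * wt R x `^ p * grad p u x.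
have G0 x : 0 <= G x by rewrite !mulr_ge0 ?powR_ge0 ?grad_ge0.
have byparts : (\tsum_(x) (c * (ph x * g x)) <=
    \tsum_(x) \sum_i (`|hardy_flux K s i x| * `|g x - g (x + up i)|))%E.
  apply: (sum_by_parts fu g0 gA) => x; first by rewrite !mulr_ge0// ltW.
  by rewrite mulrA [leRHS]mulrC ler_wpM2r//; exact: hdiv.
have edge i x : `|hardy_flux K s i x| * `|g x - g (x + up i)| <=
    C1 * e * (ph x * g x) + C1 * e * C1 * (ph (x + up i) * g (x + up i))
    + C1 * Ce * G x.
  have W0 := wt_ge0 R x.
  have h1 : wt R x * `|g x - g (x + up i)| <=
      e * (g x + g (x + up i)) + Ce * (wt R x `^ p * grad p u x).
    apply: le_trans (young _ _ _ W0 (normr_ge0 _) (normr_ge0 _)) _.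
    rewrite lerD2l ler_wpM2l// powRM// ler_wpM2l ?powR_ge0//.
    apply: le_trans (grad_ge p u x (i, true)).
    apply: ler_powRl; rewrite ?(ltW p0)// distrC.
    exact: ler_dist_dist.
  have h2 : C1 * ph x * (e * g (x + up i)) <=
      C1 * (C1 * ph (x + up i)) * (e * g (x + up i)).
    apply: ler_wpM2r; first by rewrite mulr_ge0 ?(ltW e0).
    by apply: ler_wpM2l; rewrite ?(ltW C10).
  have h3 : `|hardy_flux K s i x| * `|g x - g (x + up i)| <=
     C1 * ph x * (e * (g x + g (x + up i)) + Ce * (wt R x `^ p * grad p u x)).
    apply: (@le_trans _ _ (C1 * ph x * wt R x * `|g x - g (x + up i)|)).
      by rewrite ler_wpM2r.
    by rewrite -[leLHS]mulrA ler_wpM2l// mulr_ge0// ltW.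
  by apply: le_trans h3 _; rewrite /G; lra.
have [B B0 BE] : exists2 B : R, 0 <= B & tsum G = B%:E.
  have [|D finD uD] := @finite_support_grad R N u _ fu.
    by move=> x /negP; rewrite negbK => /eqP.
  apply: (tsum_fin_supp finD) => // x /uD[ux uj].
  rewrite /G /grad big1 ?mulr0// => j _.
  by rewrite ux uj subrr normr0 powR0// gt_eqF.
have total : c * T <= c / 2 * T + N%:R * C1 * Ce * B.
  move: byparts; rewrite tsumZ ?(ltW c0)//; last by move=> x; rewrite mulr_ge0.
  rewrite TE tsum_sum; last by move=> i x; rewrite mulr_ge0.
  have bound i : (\tsum_(x) (`|hardy_flux K s i x| * `|g x - g (x + up i)|) <=
      (C1 * e * T + C1 * e * C1 * T + C1 * Ce * B)%:E)%E.
    apply: le_trans (le_tsum (edge i)) _.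
    have a0 : 0 <= C1 * e by rewrite mulr_ge0 ?(ltW C10) ?(ltW e0).
    have a1 : 0 <= C1 * e * C1 by rewrite mulr_ge0 ?(ltW C10).
    have a2 : 0 <= C1 * Ce by rewrite mulr_ge0 ?(ltW C10).
    have b0 x : 0 <= ph x * g x by rewrite mulr_ge0.
    rewrite tsumD; [|by move=> x; rewrite addr_ge0// mulr_ge0|by move=> x; rewrite mulr_ge0].
    rewrite tsumD; [|by move=> x; rewrite mulr_ge0|by move=> x; rewrite mulr_ge0].
    rewrite !tsumZ// (tsum_shift (fun x => ph x * g x)) TE BE.
    by rewrite -!EFinM -!EFinD.
  move=> h; have := le_trans h (lee_sum _ (fun i _ => bound i)).
  rewrite sumEFin -EFinM lee_fin sumr_const card_ord -mulr_natl => h'.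
  apply: le_trans h' _; rewrite le_eqVlt; apply/orP; left; apply/eqP.
  by rewrite /e /d; field; rewrite !gt_eqF// addr_gt0.
have {}total : T <= 2 / c * (N%:R * C1 * Ce) * B.
  rewrite [leRHS](_ : _ = (N%:R * C1 * Ce * B) / (c / 2)); last by field; rewrite gt_eqF.
  by rewrite ler_pdivlMr ?divr_gt0//; lra.
have h1 : (mass s p u <= (KK * T)%:E)%E.
  rewrite EFinM -TE -tsumZ; [|exact: KK0|by move=> y; rewrite mulr_ge0].
  apply: le_tsum => x; rewrite mulrA ler_wpM2r//.
  by have [] := powR_shift s K1 (l10 x).
have h2 : (B%:E <= KK%:E * energy (s + p) p u)%E.
  rewrite -BE -tsumZ; [|exact: KK0|by move=> y; exact: energy_term_ge0].
  apply: le_tsum => x; rewrite mulrA ler_wpM2r ?grad_ge0//.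
  rewrite powRD; last by apply/implyP => _; rewrite gt_eqF ?wt_gt0.
  rewrite mulrA ler_wpM2r ?powR_ge0//.
  by have [] := powR_shift s K1 (l10 x).
apply: le_trans h1 _.
apply: (@le_trans _ _ (KK * (2 / c * (N%:R * C1 * Ce) * B))%:E).
  by rewrite lee_fin ler_wpM2l.
set D := 2 / c * _.
have D0 : 0 <= D by rewrite /D !mulr_ge0 ?(ltW NR) ?(ltW C10) ?invr_ge0 ?(ltW c0).
rewrite mulrA EFinM (_ : D * (KK * KK) = KK * D * KK); last by ring.
rewrite [in leRHS]EFinM -muleA; apply: lee_wpmul2l => //.
by rewrite lee_fin mulr_ge0.
Qed.

End hardy.

(** * A weighted Faber-Krahn inequality *)

Section faber_krahn.
Variables (R : realType) (N : nat).
Implicit Types (u v : lattice N -> R) (x y z : lattice N).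

Definition shell x : nat := trunc_log 2 (l1 x).+1.

Lemma shell_wt x : 2 ^+ shell x <= wt R x < 2 * 2 ^+ shell x.
Proof.
have /andP[h1 h2] := @trunc_log_bounds 2 (l1 x).+1 isT isT.
by rewrite /wt addrC natr1 -exprS -!natrX ler_nat ltr_nat h1.
Qed.

(** Wide enough to contain every point within distance [2^k / 2] of shell [k]. *)
Definition near_shell k x : bool :=
  (2 ^+ k / 2 <= wt R x) && (wt R x <= 4 * 2 ^+ k).

Lemma shell_near x z k : shell x = k -> (l1 z)%:R <= 2 ^+ k / 2 :> R ->
  near_shell k (x + z).
Proof.
move=> xk zl; have := shell_wt x; rewrite xk /near_shell => /andP[h1 h2].
have h3 : wt R x <= wt R (x + z) + (l1 z)%:R.
  have := l1D (x + z) (- z); rewrite addrK l1N => h.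
  by rewrite /wt -addrA -natrD lerD2l ler_nat.
have h4 : wt R (x + z) <= wt R x + (l1 z)%:R.
  by rewrite /wt -addrA -natrD lerD2l ler_nat l1D.
by apply/andP; split; lra.
Qed.

Lemma near_shell_wt k x : near_shell k x ->
  wt R x <= 4 * 2 ^+ k /\ 2 ^+ k <= 4 * wt R x.
Proof. by move=> /andP[h1 h2]; split=> //; have := wt_gt0 R x; lra. Qed.

Lemma shell_powR s x :
  wt R x `^ s <= 2 `^ `|s| * (2 ^+ shell x) `^ s /\
  (2 ^+ shell x) `^ s <= 2 `^ `|s| * wt R x `^ s.
Proof.
have /andP[h1 h2] := shell_wt x; have h3 := wt_gt0 R x.
have h4 : 0 < (2 : R) ^+ shell x by exact: exprn_gt0.
move: (2 ^+ shell x) (wt R x) h1 h2 h3 h4 => Q W h1 h2 h3 h4.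
by split; apply: powR_comparable; lra.
Qed.

Lemma near_shell_powR s k x : near_shell k x ->
  wt R x `^ s <= 4 `^ `|s| * (2 ^+ k) `^ s /\
  (2 ^+ k) `^ s <= 4 `^ `|s| * wt R x `^ s.
Proof.
move=> /near_shell_wt[h1 h2]; have h3 := wt_gt0 R x.
have h4 : 0 < (2 : R) ^+ k by exact: exprn_gt0.
move: (2 ^+ k) (wt R x) h1 h2 h3 h4 => Q W h1 h2 h3 h4.
by split; apply: powR_comparable; lra.
Qed.

Lemma count_shift K m c : (\sum_(k < K) (k + m == c) <= 1)%N.
Proof.
case: (pickP (fun k : 'I_K => k + m == c)%N) => [k /eqP kc|none].
  rewrite (bigD1 k)//= kc eqxx big1// => i ik; apply/eqP; rewrite eqb0.
  by rewrite -kc eqn_add2r.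
by rewrite big1// => k _; rewrite none.
Qed.

(** Each point is near boundedly many shells, so the estimates in the separate
    shells can be added up. *)
Lemma near_shell_count K x : (\sum_(k < K) near_shell k x <= 4)%N.
Proof.
have aux (X Y Z : R) : X / 2 <= Z -> Z < 2 * Y -> X < 4 * Y by lra.
have near k : near_shell k x -> (shell x <= k + 2 <= shell x + 3)%N.
  have := shell_wt x => /andP[h1 h2] /andP[h3 h4]; set j := shell x in h1 h2 *.
  have e2 i : (2 : R) ^+ (i + 2) = 4 * 2 ^+ i.
    by rewrite addnC exprD expr2 -natrM.
  have h5 : (2 : R) ^+ j <= 2 ^+ (k + 2) by rewrite e2 (le_trans h1).
  have h7 : (2 : R) ^+ k < 2 ^+ (j + 2).
    by rewrite e2; exact: aux h3 h2.
  rewrite ler_eXn2l ?ltr1n// in h5; rewrite ltr_eXn2l ?ltr1n// in h7.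
  by apply/andP; split; lia.
apply: (@leq_trans (\sum_(k < K) \sum_(i < 4) (k + 2 == shell x + i))%N).
  apply: leq_sum => k _; case: (boolP (near_shell k x)) => // /near/andP[h1 h2].
  have h : (k + 2 - shell x < 4)%N by lia.
  rewrite (bigD1 (Ordinal h))//= subnKC// eqxx//.
rewrite exchange_big /=; apply: (@leq_trans (\sum_(i < 4) 1)%N).
  by apply: leq_sum => i _; exact: count_shift.
by rewrite sum_nat_const card_ord.
Qed.

(** [alphaE] says that both sides of the inequality below scale in the same way
    under dilations. *)
Variables (p beta alpha tau : R).
Let theta := p * tau / N%:R.
Hypotheses (p1 : 1 < p) (N0 : (0 < N)%N) (tau0 : 0 <= tau) (tau1 : tau <= 1)
  (alphaE : alpha = beta * (1 - theta) + p * (1 - tau)).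

(** Let [Q = 2^k] be the radius of the shell.  A set of weighted measure [M] has at
    most a constant times [M Q^-beta] points near the shell, so a cube of side about
    [rho] contains twice as many points.  If [rho] is not small against [Q], then
    [M^theta] is so large that the Hardy term dominates pointwise.  Otherwise the
    cubes fit near the shell and [local_poincare] applies with [r] about [rho];
    of the factor [rho^p] the part [rho^(p tau)] yields [M^theta] and the rest is
    bounded by [Q^(p (1 - tau))]. *)
Lemma shell_faber_krahn : exists2 C : R, 0 <= C &
  forall v (chi : lattice N -> bool) (M : R) (k : nat),
    (forall x, v x != 0 -> chi x) ->
    \tsum_(x) ((chi x)%:R * wt R x `^ beta) = M%:E ->
  (\tsum_(x) ((shell x == k)%:R * (wt R x `^ beta * `|v x| `^ p)) <=
   (C * M `^ theta)%:E *
    (\tsum_(x) ((near_shell k x)%:R * (wt R x `^ alpha * grad p v x)) +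
     \tsum_(x) ((shell x == k)%:R * (wt R x `^ (alpha - p) * `|v x| `^ p))))%E.
Proof.
have p0 : 0 < p by exact: lt_trans ltr01 p1.
have NR : 0 < N%:R :> R by rewrite ltr0n.
have theta0 : 0 <= theta by rewrite divr_ge0 ?mulr_ge0 ?(ltW p0) ?(ltW NR).
have [A AE] : {A : R | A = 2 * 4 `^ `|beta|} by exists (2 * 4 `^ `|beta|).
have [B2 B2E] : {B2 : R | B2 = 2 `^ `|beta|} by exists (2 `^ `|beta|).
have A0 : 0 < A by rewrite AE mulr_gt0// powR_gt0.
have B20 : 0 < B2 by rewrite B2E powR_gt0.
have [C1 C1E] : {C1 : R | C1 = ((8 * N%:R) `^ N%:R * (A * B2)) `^ theta}.
  by exists (((8 * N%:R) `^ N%:R * (A * B2)) `^ theta).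
have [C2 C2E] : {C2 : R | C2 = B2 * 2 * (2 * N%:R) `^ p * 4 `^ `|alpha| * A `^ theta}.
  by exists (B2 * 2 * (2 * N%:R) `^ p * 4 `^ `|alpha| * A `^ theta).
have C10 : 0 <= C1 by rewrite C1E powR_ge0.
have C20 : 0 <= C2 by rewrite C2E !mulr_ge0 ?powR_ge0// ltW.
exists (C1 + C2); first exact: addr_ge0.
move=> v chi M k vchi ME.
pose Q : R := 2 ^+ k; have Q0 : 0 < Q by exact: exprn_gt0.
have t0 x : 0 <= (chi x)%:R * wt R x `^ beta by rewrite mulr_ge0 ?powR_ge0.
have M0 : 0 <= M by rewrite -lee_fin -ME; exact: tsum_ge0.
have Mth0 : 0 <= M `^ theta by exact: powR_ge0.
pose E1 := \tsum_(x) ((near_shell k x)%:R * (wt R x `^ alpha * grad p v x)).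
pose E2 := \tsum_(x) ((shell x == k)%:R * (wt R x `^ (alpha - p) * `|v x| `^ p)).
rewrite -/E1 -/E2.
have E10 : (0 <= E1)%E by apply: tsum_ge0 => x; rewrite mulr_ge0 ?energy_term_ge0.
have E20 : (0 <= E2)%E by apply: tsum_ge0 => x; rewrite mulr_ge0 ?mass_term_ge0.
have [rho rhoE] : {rho : R | rho = (A * (M * Q `^ (- beta))) `^ N%:R^-1}.
  by exists ((A * (M * Q `^ (- beta))) `^ N%:R^-1).
have AM0 : 0 <= A * (M * Q `^ (- beta)) by rewrite !mulr_ge0 ?powR_ge0// ltW.
have rho0 : 0 <= rho by rewrite rhoE powR_ge0.
have rhoN : rho `^ N%:R = A * (M * Q `^ (- beta)).
  by rewrite rhoE -powRrM mulVf ?gt_eqF// powRr1.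
have QV s : Q `^ s * Q `^ (- s) = 1 by rewrite -powRDp// subrr powRr0.
have wtQ s x : shell x = k -> wt R x `^ s <= 2 `^ `|s| * Q `^ s /\
    Q `^ s <= 2 `^ `|s| * wt R x `^ s by move=> xk; have := shell_powR s x; rewrite xk.
have wtQ' s x : near_shell k x -> wt R x `^ s <= 4 `^ `|s| * Q `^ s /\
    Q `^ s <= 4 `^ `|s| * wt R x `^ s by exact: near_shell_powR.
(* The factor 4 N leaves room for N r <= Q / 2 with r <= 2 rho. *)
have [large|small] := ltP Q (4 * N%:R * rho).
  apply: (@le_trans _ _ ((C1 * M `^ theta)%:E * E2)%E).
    apply: le_tsumZ => [|x|x]; [by rewrite mulr_ge0|by rewrite mulr_ge0 ?mass_term_ge0|].
    case: eqP => [xk|_]; last by rewrite !mul0r mulr0.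
    rewrite !mul1r mulrA ler_wpM2r ?powR_ge0//.
    have W0 := wt_gt0 R x.
    rewrite (_ : beta = (alpha - p) + (beta + N%:R) * theta); last first.
      by rewrite alphaE /theta; field; rewrite gt_eqF.
    rewrite powRDp// mulrC ler_wpM2r ?powR_ge0// powRrM C1E -powRM ?powR_ge0//; last first.
      by rewrite mulr_ge0 ?powR_ge0// mulr_ge0// ltW.
    apply: ler_powRl; rewrite ?powR_ge0//.
    rewrite addrC powRDp//.
    have h1 : wt R x `^ N%:R <= (8 * N%:R) `^ N%:R * (A * (M * Q `^ (- beta))).
      rewrite -rhoN -powRM ?mulr_ge0//; apply: ler_powRl => //; first exact: ltW.
      have := shell_wt x; rewrite xk -/Q => /andP[_ h2].
      by apply: le_trans (ltW h2) _; lra.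
    have [_] := wtQ (- beta) x xk; rewrite normrN -B2E => h2.
    apply: (@le_trans _ _
        ((8 * N%:R) `^ N%:R * (A * (M * (B2 * wt R x `^ (- beta)))) * wt R x `^ beta)).
      rewrite ler_wpM2r ?powR_ge0//; apply: le_trans h1 _.
      by rewrite ler_wpM2l ?powR_ge0// ler_wpM2l ?(ltW A0)// ler_wpM2l.
    have WV : wt R x `^ (- beta) * wt R x `^ beta = 1 by rewrite -powRDp// addNr powRr0.
    rewrite le_eqVlt; apply/orP; left; apply/eqP.
    by rewrite -[RHS]mulr1 -WV; ring.
  apply: lee_pmul => //; rewrite ?lee_fin ?mulr_ge0//.
  - by rewrite ler_wpM2r// lerDl.
  - by rewrite leeDr.
have C12 : 0 <= (C1 + C2) * M `^ theta by rewrite mulr_ge0// addr_ge0.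
have [[x0 [x0k vx0]]|none] := pselect (exists x, shell x = k /\ v x != 0); last first.
  rewrite [leLHS](_ : _ = 0%E); first by rewrite mule_ge0 ?adde_ge0.
  transitivity (tsum (fun _ : lattice N => 0 : R)); last exact: tsum0.
  apply: eq_tsum => x; case: eqP => [xk|_]; last by rewrite mul0r.
  have [->|vx] := eqVneq (v x) 0; first by rewrite normr0 powR0 ?mulr0// gt_eqF.
  by exfalso; apply: none; exists x.
(* A single point of the set in the shell already forces rho >= 1, so rounding
   rho up to an integer at most doubles it. *)
have rho1 : 1 <= rho.
  rewrite rhoE -[leLHS](_ : 1 `^ N%:R^-1 = 1); last by rewrite powR1.
  apply: ler_powRl => //.
  have h1 : wt R x0 `^ beta <= M.
    rewrite -lee_fin -ME.
    by apply: le_trans (tsum_ge_term x0 t0); rewrite vchi// mul1r.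
  have [_] := wtQ beta x0 x0k; rewrite -B2E => h2.
  have h3 : 1 <= B2 * M * Q `^ (- beta).
    rewrite -(QV beta) ler_wpM2r ?powR_ge0//; apply: le_trans h2 _.
    by rewrite ler_wpM2l// ltW.
  apply: le_trans h3 _; rewrite mulrA ler_wpM2r ?powR_ge0// ler_wpM2r//.
  rewrite AE B2E; have : (2 : R) `^ `|beta| <= 4 `^ `|beta|.
    by apply: ler_powRl => //; lra.
  by have := @powR_ge0 R 4 `|beta|; lra.
pose r := (Num.truncn rho).+1.
have /andP[r1 r2] := truncn_itv rho0.
have rr : rho <= r%:R by exact: ltW.
have r2rho : r%:R <= 2 * rho :> R by rewrite /r -natr1; lra.
have NrQ : (N * r)%:R <= Q / 2.
  rewrite natrM; apply: (@le_trans _ _ (N%:R * (2 * rho))).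
    by rewrite ler_wpM2l// ltW.
  by lra.
have poin : (\tsum_(x) ((shell x == k)%:R * `|v x| `^ p) <=
    (2 * (N * r)%:R `^ p)%:E * \tsum_(x) ((near_shell k x)%:R * grad p v x))%E.
  apply: local_poincare => //; last first.
    move=> x z /eqP xk zr; apply: shell_near => //.
    by apply: le_trans NrQ; rewrite ler_nat.
  move=> x /eqP xk vx; rewrite -(ler_nat R) natrM natrX.
  apply: (@le_trans _ _ (A * (M * Q `^ (- beta)))); last first.
    rewrite -rhoN -powR_mulrn ?ler0n//; apply: ler_powRl => //; exact: ltW.
  set H := [pred h | _].
  have hM : (4 `^ `|beta|)^-1 * Q `^ beta * #|H|%:R <= M.
    rewrite -lee_fin -ME; apply: le_trans
        (tsum_inj_le (e := fun h => x + @box_point N r h) t0 _);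
      last first.
      by move=> h h' /addrI/box_point_inj.
    rewrite esum_fintype// lee_fin -sum1_card natr_sum mulr_sumr big_mkcond.
    apply: ler_sum => h _; case: ifP => [|_]; last exact: t0.
    rewrite inE => /vchi ->; rewrite mul1r mulr1 ler_pdivrMl ?powR_gt0//.
    apply: (wtQ' beta _ _).2; apply: shell_near => //.
    by apply: le_trans NrQ; rewrite ler_nat l1_box_point.
  rewrite AE -mulrA ler_wpM2l//.
  have eH : #|H|%:R = 4 `^ `|beta| * ((4 `^ `|beta|)^-1 * Q `^ beta * #|H|%:R * Q `^ (- beta)) :> R.
    transitivity (#|H|%:R * (Q `^ beta * Q `^ (- beta))); first by rewrite QV mulr1.
    by field; rewrite gt_eqF// powR_gt0.
  by rewrite eH; apply: ler_wpM2l; rewrite ?powR_ge0// ler_wpM2r ?powR_ge0.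
have g0 x : 0 <= (near_shell k x)%:R * grad p v x by rewrite mulr_ge0 ?grad_ge0.
have s0 x : 0 <= (shell x == k)%:R * `|v x| `^ p by rewrite mulr_ge0 ?powR_ge0.
apply: (@le_trans _ _ ((B2 * Q `^ beta)%:E * \tsum_(x) ((shell x == k)%:R * `|v x| `^ p))%E).
  apply: le_tsumZ => [|//|x]; first by rewrite mulr_ge0 ?powR_ge0 ?(ltW B20).
  case: eqP => [xk|_]; last by rewrite !mul0r mulr0.
  by rewrite !mul1r ler_wpM2r ?powR_ge0// B2E; exact: (wtQ beta x xk).1.
apply: (@le_trans _ _ ((B2 * Q `^ beta)%:E * ((2 * (N * r)%:R `^ p)%:E *
    ((4 `^ `|alpha| * Q `^ (- alpha))%:E * E1)))%E).
  apply: lee_wpmul2l; first by rewrite lee_fin mulr_ge0 ?powR_ge0 ?(ltW B20).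
  apply: le_trans poin _.
  apply: lee_wpmul2l; first by rewrite lee_fin mulr_ge0 ?powR_ge0.
  apply: le_tsumZ => [|x|x]; [by rewrite mulr_ge0 ?powR_ge0|by rewrite mulr_ge0 ?energy_term_ge0|].
  case: (boolP (near_shell k x)) => xk; last by rewrite !mul0r mulr0.
  rewrite !mul1r mulrA ler_peMl ?grad_ge0//.
  have [_ h] := wtQ' alpha x xk; rewrite mulrAC.
  apply: (@le_trans _ _ (Q `^ alpha * Q `^ (- alpha))); first by rewrite QV.
  by rewrite ler_wpM2r ?powR_ge0.
rewrite !muleA -!EFinM; apply: lee_pmul => //; last by rewrite leeDl.
  by rewrite lee_fin !mulr_ge0 ?powR_ge0 ?(ltW B20).
rewrite lee_fin; apply: (@le_trans _ _ (C2 * M `^ theta)); last by rewrite ler_wpM2r// lerDr.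
have rp : (N * r)%:R `^ p <=
    (2 * N%:R) `^ p * (A `^ theta * M `^ theta * Q `^ (- (beta * theta)) * Q `^ (p * (1 - tau))).
  apply: (@le_trans _ _ ((2 * N%:R) `^ p * rho `^ p)).
    rewrite -powRM ?mulr_ge0//; apply: ler_powRl; rewrite ?(ltW p0)// natrM.
    rewrite (_ : 2 * N%:R * rho = N%:R * (2 * rho)); last by ring.
    exact: ler_wpM2l.
  rewrite ler_wpM2l ?powR_ge0//.
  rewrite [X in rho `^ X](_ : p = N%:R * theta + p * (1 - tau)); last first.
    by rewrite /theta; field; rewrite gt_eqF.
  rewrite powRDp ?(lt_le_trans ltr01 rho1)// powRrM rhoN.
  rewrite !powRM ?mulr_ge0 ?powR_ge0 ?(ltW A0)// -powRrM -mulNr mulrA.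
  rewrite ler_wpM2l ?mulr_ge0 ?powR_ge0//.
  apply: ler_powRl => //; first by rewrite mulr_ge0 ?(ltW p0) ?subr_ge0.
  apply: le_trans small; rewrite ler_peMl// -natrM ler1n muln_gt0//.
have Qs : Q `^ beta * Q `^ (- alpha) * Q `^ (- (beta * theta)) * Q `^ (p * (1 - tau)) = 1.
  rewrite -!powRDp// (_ : beta + - alpha + - (beta * theta) + p * (1 - tau) = 0) ?powRr0//.
  by rewrite alphaE; ring.
apply: (@le_trans _ _ (B2 * Q `^ beta * (2 * ((2 * N%:R) `^ p *
   (A `^ theta * M `^ theta * Q `^ (- (beta * theta)) * Q `^ (p * (1 - tau))))) *
       (4 `^ `|alpha| * Q `^ (- alpha)))).
  rewrite ler_wpM2r ?mulr_ge0 ?powR_ge0// ler_wpM2l ?mulr_ge0 ?powR_ge0 ?(ltW B20)//.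
  by rewrite ler_wpM2l.
rewrite le_eqVlt; apply/orP; left; apply/eqP.
transitivity (C2 * M `^ theta *
  (Q `^ beta * Q `^ (- alpha) * Q `^ (- (beta * theta)) * Q `^ (p * (1 - tau)))).
  by rewrite C2E; ring.
by rewrite Qs mulr1.
Qed.

Lemma weighted_faber_krahn : exists2 C : R, 0 <= C &
  forall v (chi : lattice N -> bool) (M : R), finitely_supported v ->
    (forall x, v x != 0 -> chi x) ->
    \tsum_(x) ((chi x)%:R * wt R x `^ beta) = M%:E ->
  (mass beta p v <= (C * M `^ theta)%:E * (energy alpha p v + mass (alpha - p) p v))%E.
Proof.
have [C C0 H] := shell_faber_krahn; exists (4 * C); first by rewrite mulr_ge0.
move=> v chi M fv vchi ME.
have p0 : 0 < p by exact: lt_trans ltr01 p1.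
have [K vK] : exists K, forall x, v x != 0 -> (shell x < K)%N.
  move: fv; rewrite /finitely_supported /= => /finite_seqP[s sE].
  exists (\max_(x <- s) shell x).+1 => x vx.
  have : x \in s by have : [set x | v x != 0] x by []; rewrite sE.
  by move=> xs; rewrite ltnS; exact: leq_bigmax_seq.
have sh0 x k : 0 <= (shell x == k)%:R * (wt R x `^ beta * `|v x| `^ p).
  by rewrite mulr_ge0 ?mass_term_ge0.
have -> : mass beta p v =
    (\sum_(k < K) \tsum_(x) ((shell x == k)%:R * (wt R x `^ beta * `|v x| `^ p)))%E.
  rewrite -(@tsum_sum _ _ _ _
      (fun (k : 'I_K) x => (shell x == k)%:R * (wt R x `^ beta * `|v x| `^ p)))//.
  apply: eq_tsum => x; rewrite -mulr_suml.
  have [->|/vK xK] := eqVneq (v x) 0; first by rewrite normr0 powR0 ?gt_eqF// !mulr0.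
  rewrite (bigD1 (Ordinal xK))//= eqxx big1 ?addr0 ?mul1r// => k /negbTE kx.
  by rewrite eq_sym -[(k : nat) == shell x]/(k == Ordinal xK) kx.
apply: le_trans (lee_sum _ (fun (k : 'I_K) _ => H v chi M k vchi ME)) _.
rewrite -ge0_sume_distrr; last first.
  move=> k _; apply: adde_ge0; apply: tsum_ge0 => x;
  by rewrite mulr_ge0 ?energy_term_ge0 ?mass_term_ge0.
rewrite big_split /=.
have e1 : (\sum_(k < K) \tsum_(x) ((near_shell k x)%:R * (wt R x `^ alpha * grad p v x)) <=
   4%:E * energy alpha p v)%E.
  rewrite -(@tsum_sum _ _ _ _
      (fun (k : 'I_K) x => (near_shell k x)%:R * (wt R x `^ alpha * grad p v x)));
    last first.
    by move=> k x; rewrite mulr_ge0 ?energy_term_ge0.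
  apply: le_tsumZ => // x; first exact: energy_term_ge0.
  rewrite -mulr_suml ler_wpM2r ?energy_term_ge0//.
  rewrite -natr_sum ler_nat.
  exact: near_shell_count.
have e2 : (\sum_(k < K) \tsum_(x) ((shell x == k)%:R * (wt R x `^ (alpha - p) * `|v x| `^ p)) <=
   mass (alpha - p) p v)%E.
  rewrite -(@tsum_sum _ _ _ _
      (fun (k : 'I_K) x => (shell x == k)%:R * (wt R x `^ (alpha - p) * `|v x| `^ p)));
    last first.
    by move=> k x; rewrite mulr_ge0 ?mass_term_ge0.
  apply: le_tsum => x; rewrite -mulr_suml ler_piMl ?mass_term_ge0//.
  rewrite -natr_sum lern1 (eq_bigr (fun k : 'I_K => (k + 0 == shell x)%N : nat)).
    exact: count_shift.
  by move=> k _; rewrite addn0 eq_sym.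
have e0 := mass_ge0 (alpha - p) p v.
apply: (@le_trans _ _ ((C * M `^ theta)%:E * (4%:E * (energy alpha p v + mass (alpha - p) p v)))%E).
  apply: lee_wpmul2l; first by rewrite lee_fin mulr_ge0 ?powR_ge0.
  rewrite (ge0_muleDr _ (energy_ge0 _ _ _) e0); apply: leeD; first exact: e1.
  by apply: le_trans e2 _; rewrite lee_pemull// lee_fin ler1n.
by rewrite muleA -EFinM (_ : C * M `^ theta * 4 = 4 * C * M `^ theta)//; ring.
Qed.

End faber_krahn.

(** * Slicing by levels and the weighted Sobolev inequality *)

Section levels.
Variable R : realType.
Implicit Types (e s t p : R).

(** The part of [t] between the levels [e 2^j] and [e 2^(j+1)]; as a difference of
    truncations it telescopes in [j]. *)
Definition slice e j t : R := Num.min t (e * 2 ^+ j.+1) - Num.min t (e * 2 ^+ j).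

Lemma slice_mono e j : 0 < e -> {homo slice e j : s t / s <= t}.
Proof.
move=> e0 s t st; have : 0 < e * 2 ^+ j by rewrite mulr_gt0// exprn_gt0.
rewrite /slice exprS mulrCA; set a := e * _ => a0.
by rewrite !minEle; do 4 (case: ifPn; rewrite -?ltNge => ?); lra.
Qed.

(** The slices are monotone in [t] and telescope, so the differences of all slices
    add up to at most [|s - t|], and [sum_powR_le] passes to powers. *)
Lemma sum_slice_le p e J s t : 1 < p -> 0 < e ->
  \sum_(j < J) `|slice e j s - slice e j t| `^ p <= `|s - t| `^ p.
Proof.
move=> p1 e0; have p0 : 0 < p by lra.
wlog ts : s t / t <= s.
  move=> H; have [st|/ltW ts] := leP s t; last exact: H.
  by rewrite distrC; under eq_bigr do rewrite distrC; exact: H.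
apply: le_trans (sum_powR_le _ p1 _) _ => //.
apply: ler_powRl; rewrite ?(ltW p0)//; first exact: sumr_ge0.
under eq_bigr do rewrite ger0_norm ?subr_ge0 ?slice_mono//.
rewrite ger0_norm ?subr_ge0// sumrB.
have tele r : \sum_(j < J) slice e j r = Num.min r (e * 2 ^+ J) - Num.min r (e * 2 ^+ 0).
  by rewrite -(big_mkord predT (fun j => slice e j r)) /= telescope_sumr.
by rewrite !tele !minEle; do 4 (case: ifPn; rewrite -?ltNge => ?); lra.
Qed.

Lemma slice_top e j t : 0 < e -> e * 2 ^+ j.+1 <= t -> slice e j t = e * 2 ^+ j.
Proof.
move=> e0; rewrite /slice exprS mulrCA => h.
have a0 : 0 < e * 2 ^+ j by rewrite mulr_gt0// exprn_gt0.
by rewrite !min_r//; lra.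
Qed.

Lemma slice_bottom e j t : 0 < e -> slice e j t != 0 -> e * 2 ^+ j <= t.
Proof.
move=> e0; rewrite /slice exprS mulrCA; apply: contraNT; rewrite -ltNge => h.
have a0 : 0 < e * 2 ^+ j by rewrite mulr_gt0// exprn_gt0.
by rewrite !min_l ?subrr//; lra.
Qed.

Lemma slice0 e j : 0 < e -> slice e j 0 = 0.
Proof.
by move=> e0; rewrite /slice !min_l ?subrr// mulr_ge0 ?exprn_ge0// ltW.
Qed.

Lemma dyadic_level e J t : 0 < e -> 2 * e <= t -> t < e * 2 ^+ J ->
  exists2 j : 'I_J, e * 2 ^+ j.+1 <= t & t <= 4 * (e * 2 ^+ j).
Proof.
move=> e0 et; elim: J => [|J ih] h; first by rewrite expr0 in h; lra.
have [/ih[j h1 h2]|tJ] := ltP t (e * 2 ^+ J).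
  by exists (widen_ord (leqnSn J) j).
case: J => [|J] in ih h tJ *; first by rewrite expr1 in h; lra.
exists (widen_ord (leqnSn J.+1) ord_max) => //=.
by move: h; rewrite !exprS; lra.
Qed.

End levels.

Section sobolev.
Variables (R : realType) (N : nat) (p q beta alpha tau : R).
Let theta := p * tau / N%:R.
Hypotheses (p1 : 1 < p) (N0 : (0 < N)%N) (tau0 : 0 <= tau) (tau1 : tau <= 1)
  (alphaE : alpha = beta * (1 - theta) + p * (1 - tau)) (theta1 : theta < 1)
  (qE : q * (1 - theta) = p) (hN : 0 < N%:R + (alpha - p)).

(** The slice at level [tj j] equals [tj j] on the next level set, so the
    Faber-Krahn inequality reads [tj^p m (j+1) <= C (m j)^theta (E j + H j)].
    Multiplied by [tj^(q - p) = (tj^q)^theta] it becomes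
    [tj^q m (j+1) <= C (tj^q m j)^theta (E j + H j)], where [tj^q m j <= M] by
    Chebyshev's inequality, and [M] is at most [4^q] times the sum of the left
    sides. *)
Lemma weighted_sobolev : exists2 C : R, 0 <= C &
  forall (u : lattice N -> R) (M P : R), finitely_supported u ->
    mass beta q u = M%:E -> energy alpha p u = P%:E -> M `^ (1 - theta) <= C * P.
Proof.
have p0 : 0 < p by exact: lt_trans ltr01 p1.
have NR : 0 < N%:R :> R by rewrite ltr0n.
have theta0 : 0 <= theta by rewrite divr_ge0 ?mulr_ge0 ?(ltW p0) ?(ltW NR).
have q0 : 0 < q.
  have h : 0 < 1 - theta by rewrite subr_gt0.
  by rewrite -(pmulr_lgt0 q h) qE.
have [CF CF0 FK] := @weighted_faber_krahn R N p beta alpha tau p1 N0 tau0 tau1 alphaE.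
have [CH CH0 HA] := hardy p1 N0 hN.
exists (4 `^ q * CF * (1 + CH)); first by rewrite !mulr_ge0 ?powR_ge0// addr_ge0.
move=> u M P fu ME PE.
have P0 : 0 <= P by rewrite -lee_fin -PE energy_ge0.
have M0 : 0 <= M by rewrite -lee_fin -ME mass_ge0.
have [->|Mn0] := eqVneq M 0.
  rewrite powR0 ?subr_eq0; last by rewrite gt_eqF.
  by rewrite !mulr_ge0 ?powR_ge0// addr_ge0.
have Mp : 0 < M by rewrite lt_neqAle eq_sym Mn0.
have [e [J [e0 eJ]]] : exists e J, 0 < e /\ forall x, u x != 0 ->
    2 * e <= `|u x| /\ `|u x| < e * 2 ^+ J.
  have := fu; rewrite /finitely_supported /= => /finite_seqP[s sE].
  have [e e0 es] : exists2 e, 0 < e & forall x, x \in s -> u x != 0 -> 2 * e <= `|u x|.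
    elim: s {sE} => [|y s [e e0 es]]; first by exists 1.
    have [uy|uy] := eqVneq (u y) 0.
      by exists e => // x; rewrite inE => /predU1P[->|/es//]; rewrite uy eqxx.
    exists (Num.min e (`|u y| / 2)); first by rewrite lt_min e0 divr_gt0// normr_gt0.
    move=> x; rewrite inE => /predU1P[-> _|/es h /h {}h].
      have : Num.min e (`|u y| / 2) <= `|u y| / 2 by rewrite ge_min lexx orbT.
      by lra.
    have : Num.min e (`|u y| / 2) <= e by rewrite ge_min lexx.
    by lra.
  pose B := \sum_(x <- s) `|u x|.
  have B0 : 0 <= B / e by rewrite divr_ge0 ?(ltW e0)//; apply: sumr_ge0.
  exists e, (Num.truncn (B / e)).+1; split=> // x ux.
  have xs : x \in s by have : [set x | u x != 0] x by []; rewrite sE.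
  split; first exact: es.
  apply: (@le_lt_trans _ _ B).
    by rewrite /B (big_rem x)//= lerDl; apply: sumr_ge0.
  have /andP[_ h] := truncn_itv B0.
  have h2 : (Num.truncn (B / e)).+1%:R <= 2 ^+ (Num.truncn (B / e)).+1 :> R.
    by rewrite -natrX ler_nat ltnW// ltn_expl.
  rewrite mulrC -ltr_pdivrMr//; exact: lt_le_trans h h2.
pose tj (j : nat) : R := e * 2 ^+ j.
have tj0 j : 0 < tj j by rewrite mulr_gt0// exprn_gt0.
pose uj j x := slice e j `|u x|.
pose chi j x := tj j <= `|u x|.
have chi0 j x : 0 <= (chi j x)%:R * wt R x `^ beta by rewrite mulr_ge0 ?powR_ge0.
have /all_sig[m mE] j : {m : R | \tsum_(x) ((chi j x)%:R * wt R x `^ beta) = m%:E}.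
  apply: cid; have [|m _ mE] := tsum_fin_supp fu (chi0 j); last by exists m.
  move=> x /negP; rewrite negbK => /eqP ux.
  by rewrite /chi ux normr0 leNgt tj0 mul0r.
have m0 j : 0 <= m j by rewrite -lee_fin -mE; exact: tsum_ge0.
have fuj j : finitely_supported (uj j).
  apply: sub_finite_set fu => x; apply: contra_neq => ux.
  by rewrite /uj ux normr0 slice0.
have /all_sig2[E E0 EE] j : {r : R | 0 <= r & energy alpha p (uj j) = r%:E}.
  by apply: cid2; exact: energy_fin.
have /all_sig2[H H0 HE] j : {r : R | 0 <= r & mass (alpha - p) p (uj j) = r%:E}.
  by apply: cid2; exact: mass_fin.
have sumE : \sum_(j < J) E j <= P.
  rewrite -lee_fin -PE -sumEFin; under eq_bigr do rewrite -EE.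
  rewrite -(@tsum_sum _ _ _ _ (fun (j : 'I_J) x => wt R x `^ alpha * grad p (uj j) x)); last first.
    by move=> j x; exact: energy_term_ge0.
  apply: le_tsum => x; rewrite -mulr_sumr ler_wpM2l ?powR_ge0// exchange_big /=.
  apply: ler_sum => j _; apply: le_trans (sum_slice_le _ _ _ p1 e0) _.
  by apply: ler_powRl; rewrite ?(ltW p0)//; exact: ler_dist_dist.
have [T T0 TE] := mass_fin (alpha - p) p0 fu.
have sumH : \sum_(j < J) H j <= T.
  rewrite -lee_fin -TE -sumEFin; under eq_bigr do rewrite -HE.
  rewrite -(@tsum_sum _ _ _ _
      (fun (j : 'I_J) x => wt R x `^ (alpha - p) * `|uj j x| `^ p));
    last first.
    by move=> j x; exact: mass_term_ge0.
  apply: le_tsum => x; rewrite -mulr_sumr ler_wpM2l ?powR_ge0//.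
  apply: le_trans (_ : _ <= `| `|u x| - 0| `^ p) _; last by rewrite subr0 normr_id.
  apply: le_trans (sum_slice_le J _ _ p1 e0); apply: ler_sum => j _.
  by rewrite slice0// subr0.
have TP : T <= CH * P.
  by have := HA u fu; rewrite subrK PE TE -EFinM lee_fin.
have mM j : tj j `^ q * m j <= M.
  rewrite -lee_fin EFinM -mE -ME -tsumZ ?powR_ge0//; apply: le_tsum => x.
  rewrite /chi; case: (boolP (tj j <= _)) => h; last by rewrite mul0r mulr0 mass_term_ge0.
  rewrite mul1r mulrC ler_wpM2l ?powR_ge0// ler_powRl ?(ltW q0)//.
  exact: ltW.
have fk j : tj j `^ q * m j.+1 <= CF * M `^ theta * (E j + H j).
  have h1 : tj j `^ p * m j.+1 <= CF * m j `^ theta * (E j + H j).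
    have := FK (uj j) (chi j) (m j) (fuj j) _ (mE j).
    rewrite EE HE -EFinD -EFinM => h.
    rewrite -lee_fin; apply: le_trans (h _); last first.
      by move=> x; exact: slice_bottom.
    rewrite EFinM -mE -tsumZ ?powR_ge0//; apply: le_tsum => x.
    rewrite /chi; case: (boolP (tj j.+1 <= _)) => hx; last by rewrite mul0r mulr0 mass_term_ge0.
    by rewrite mul1r mulrC ler_wpM2l ?powR_ge0// /uj slice_top// ger0_norm//; exact/ltW/tj0.
  have -> : tj j `^ q = (tj j `^ q) `^ theta * tj j `^ p.
    rewrite -powRrM -powRDp//; congr (_ `^ _).
    by rewrite -[in RHS]qE; ring.
  rewrite -mulrA; apply: le_trans (ler_wpM2l (powR_ge0 _ _) h1) _.
  rewrite (_ : _ `^ theta * _ =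
      CF * ((tj j `^ q) `^ theta * m j `^ theta) * (E j + H j));
    last by ring.
  rewrite ler_wpM2r ?addr_ge0// ler_wpM2l// -powRM ?powR_ge0//.
  by apply: ler_powRl => //; rewrite mulr_ge0 ?powR_ge0.
have levels : M <= \sum_(j < J) 4 `^ q * (tj j `^ q * m j.+1).
  rewrite -lee_fin -ME -sumEFin.
  rewrite (eq_bigr
      (fun j : 'I_J => \tsum_(x) (4 `^ q * (tj j `^ q * ((chi j.+1 x)%:R * wt R x `^ beta)))));
    last first.
    move=> j _; rewrite tsumZ ?powR_ge0//; last by move=> x; rewrite mulr_ge0 ?powR_ge0.
    by rewrite tsumZ ?powR_ge0// mE -!EFinM.
  have f0 (j : 'I_J) x : 0 <= 4 `^ q * (tj j `^ q * ((chi j.+1 x)%:R * wt R x `^ beta)).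
    by rewrite !mulr_ge0 ?powR_ge0.
  rewrite -(@tsum_sum _ _ _ _
      (fun (j : 'I_J) x => 4 `^ q * (tj j `^ q * ((chi j.+1 x)%:R * wt R x `^ beta))))//.
  apply: le_tsum => x; have [->|/eJ[h1 h2]] := eqVneq (u x) 0.
    by rewrite normr0 powR0 ?gt_eqF// mulr0; apply: sumr_ge0.
  have [j h3 h4] := dyadic_level e0 h1 h2.
  rewrite (bigD1 j)//=; rewrite -[leLHS]addr0 lerD//; last exact: sumr_ge0.
  rewrite /chi h3 mul1r mulrA mulrC ler_wpM2r ?powR_ge0//.
  by rewrite -powRM ?(ltW (tj0 _))//; apply: ler_powRl => //; exact: ltW.
have {}levels : M <= 4 `^ q * CF * M `^ theta * ((1 + CH) * P).
  apply: le_trans levels _; rewrite -mulr_sumr -!mulrA ler_wpM2l ?powR_ge0//.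
  apply: (@le_trans _ _ (\sum_(j < J) CF * M `^ theta * (E j + H j))).
    by apply: ler_sum => j _; exact: fk.
  rewrite -mulr_sumr -mulrA ler_wpM2l// ler_wpM2l ?powR_ge0// big_split /=; lra.
rewrite powRDp// powRN powRr1// ler_pdivrMr ?powR_gt0//.
by apply: le_trans levels _; rewrite le_eqVlt; apply/orP; left; apply/eqP; ring.
Qed.

End sobolev.

(** * Approximation by cut-offs *)

Section triangle.
Variables (R : realType) (N : nat).
Implicit Types (u v w : lattice N -> R) (x y z : lattice N).

Lemma grad_triangle p u v w x : 0 <= p -> (forall y, w y = u y + v y) ->
  grad p w x <= 2 `^ p * (grad p u x + grad p v x).
Proof.
move=> p0 wE; rewrite /grad -big_split mulr_sumr /=; apply: ler_sum => j _.
rewrite !wE opprD addrACA; apply: le_trans (powR_add_le p0 _ _) => //.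
by apply: ler_powRl => //; exact: ler_normD.
Qed.

Lemma energy_triangle alpha p u v w : 0 <= p -> (forall y, w y = u y + v y) ->
  (energy alpha p w <= (2 `^ p)%:E * (energy alpha p u + energy alpha p v))%E.
Proof.
move=> p0 wE; rewrite /energy -tsumD; try by move=> x; exact: energy_term_ge0.
apply: le_tsumZ => [|x|x]; first exact: powR_ge0.
  by rewrite addr_ge0 ?energy_term_ge0.
by rewrite -mulrDr mulrCA ler_wpM2l ?powR_ge0// grad_triangle.
Qed.

Lemma energy_opp alpha p u w : (forall y, w y = - u y) -> energy alpha p w = energy alpha p u.
Proof.
move=> wE; apply: eq_tsum => x; congr (_ * _); apply: eq_bigr => j _.
by rewrite !wE -opprD normrN.
Qed.

Lemma mass_triangle beta q u v w : 0 <= q -> (forall y, w y = u y + v y) ->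
  (mass beta q w <= (2 `^ q)%:E * (mass beta q u + mass beta q v))%E.
Proof.
move=> q0 wE; rewrite /mass -tsumD; try by move=> x; exact: mass_term_ge0.
apply: le_tsumZ => [|x|x]; first exact: powR_ge0.
  by rewrite addr_ge0 ?mass_term_ge0.
rewrite -mulrDr mulrCA ler_wpM2l ?powR_ge0// wE.
apply: le_trans (powR_add_le q0 _ _) => //.
by apply: ler_powRl => //; exact: ler_normD.
Qed.

Lemma mass_opp beta q u w : (forall y, w y = - u y) -> mass beta q w = mass beta q u.
Proof. by move=> wE; apply: eq_tsum => x; rewrite wE normrN. Qed.

End triangle.

Section balls.
Variables (R : realType) (N : nat).
Implicit Types (x y z : lattice N).

Lemma ball_box m x : (l1 x <= m)%N ->
  exists h : {ffun 'I_N -> 'I_(2 * m).+1}, x = box_point h - const_mx m%:Z.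
Proof.
move=> xm; have hi i : (`|(x ord0 i + m%:Z)%R| < (2 * m).+1)%N /\ (0 <= x ord0 i + m%:Z).
  have : (`|x ord0 i| <= m)%N.
    by apply: leq_trans xm; rewrite /l1 (bigD1 i)//= leq_addr.
  by move: (x ord0 i) => c hc; split; lia.
exists [ffun i => Ordinal (hi i).1]; apply/matrixP => i0 i.
rewrite !ord1 !mxE ffunE /=; have [_] := hi i.
by move: (x ord0 i) => c hc; lia.
Qed.

Lemma finite_ball m : finite_set [set x : lattice N | (l1 x <= m)%N].
Proof.
apply: (@sub_finite_set _ _ ((fun h : {ffun 'I_N -> 'I_(2 * m).+1} =>
    box_point h - const_mx m%:Z) @` setT)).
  by move=> x /= /ball_box[h ->]; exists h.
by apply: finite_image; exact: finite_finset.
Qed.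

Lemma tsum_ball m (c : R) : 0 <= c ->
  (\tsum_(x) ((l1 (x : lattice N) <= m)%N%:R * c) <= (c * ((2 * m).+1 ^ N)%:R)%:E)%E.
Proof.
move=> c0; pose e (h : {ffun 'I_N -> 'I_(2 * m).+1}) : lattice N :=
  box_point h - const_mx m%:Z.
have f0 x : 0 <= (l1 x <= m)%N%:R * c by rewrite mulr_ge0.
have einj : injective e by move=> h k /addIr/box_point_inj.
apply: (@le_trans _ _ (\esum_(x in e @` setT) ((l1 x <= m)%N%:R * c)%:E)).
  rewrite [leRHS]esum_mkcond; apply: le_esum => x _.
  case: ifPn => //; rewrite notin_setE => nx.
  case: (boolP (l1 x <= m)%N) => [/ball_box[h xh]|_]; last by rewrite mul0r.
  by exfalso; apply: nx; exists h.
rewrite esum_image; last by move=> ? ? _ _; exact: einj.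
rewrite esum_fintype// lee_fin.
apply: (@le_trans _ _ (\sum_(h : {ffun 'I_N -> 'I_(2 * m).+1}) c)).
  by apply: ler_sum => h _; case: (_ <= _)%N; rewrite ?mul1r ?mul0r.
by rewrite sumr_const card_box mulr_natr.
Qed.

Lemma tail_outside (f : lattice N -> R) (e : R) : (forall x, 0 <= f x) ->
    (tsum f < +oo)%E -> 0 < e ->
  exists n0 : nat, forall n, (n0 <= n)%N ->
    (\tsum_(x) ((n <= l1 x)%N%:R * f x) < e%:E)%E.
Proof.
move=> f0 ffin e0; have [A finA tA] := tsum_tail f0 ffin e0.
have /finite_seqP[s sE] := finA.
exists (\max_(x <- s) l1 x).+1 => n sn.
apply: le_lt_trans tA; apply: le_tsum => x.
case: ifPn => [|_]; last by case: (_ <= _)%N; rewrite ?mul1r ?mul0r.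
rewrite inE sE /= => xs; rewrite leqNgt (leq_trans _ sn) ?mul0r//.
by rewrite ltnS; exact: leq_bigmax_seq.
Qed.

End balls.

Section thirds.
Variable R : realType.

Lemma third_lt (k e : R) : 0 <= k -> 0 < e -> k * (e / (3 * (k + 1))) < e / 3.
Proof.
move=> k0 e0; have -> : e / 3 = (k + 1) * (e / (3 * (k + 1))) by field; lra.
by rewrite ltr_pM2r; [lra|rewrite divr_gt0//; lra].
Qed.

Lemma one_lt_3S (k : R) : 0 <= k -> 1 < 3 * (k + 1).
Proof. by lra. Qed.

Lemma add_thirds (x y z e : R) : x < e / 3 -> y < e / 3 -> z < e / 3 ->
  x + (y + z) < e.
Proof. by lra. Qed.

End thirds.

Section cutoff.
Variables (R : realType) (N : nat).
Implicit Types (u v w : lattice N -> R) (x y z : lattice N).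

Definition ramp n x : R := Num.min 1 (Num.max 0 ((l1 x)%:R / n%:R - 1)).

Lemma ramp_ge0 n x : 0 <= ramp n x.
Proof. by rewrite /ramp le_min ler01 le_max lexx. Qed.

Lemma ramp_le1 n x : ramp n x <= 1.
Proof. by rewrite /ramp ge_min lexx. Qed.

Lemma ramp_inner n x : (0 < n)%N -> (l1 x <= n)%N -> ramp n x = 0.
Proof.
move=> n0 xn; rewrite /ramp max_l ?min_r//.
by rewrite subr_le0 ler_pdivrMr ?ltr0n// mul1r ler_nat.
Qed.

Lemma ramp_outer n x : (0 < n)%N -> (2 * n <= l1 x)%N -> ramp n x = 1.
Proof.
move=> n0 xn; have h : 1 <= (l1 x)%:R / n%:R - 1 :> R.
  by rewrite lerBrDr ler_pdivlMr ?ltr0n// -[1 + 1]/(2%:R) -natrM ler_nat.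
by rewrite /ramp max_r ?min_l// (le_trans ler01).
Qed.

Lemma ramp_lipschitz n x (j : 'I_N * bool) : (0 < n)%N ->
  `|ramp n (x + step j) - ramp n x| <= n%:R^-1.
Proof.
move=> n0; have [h1 h2] := l1_step_le x j.
have n1 : 0 < n%:R^-1 :> R by rewrite invr_gt0 ltr0n.
have e (t : R) : t / n%:R + n%:R^-1 = (t + 1) / n%:R by rewrite mulrDl mul1r.
have h3 : (l1 (x + step j))%:R / n%:R <= (l1 x)%:R / n%:R + n%:R^-1 :> R.
  by rewrite e ler_pM2r// natr1 ler_nat.
have h4 : (l1 x)%:R / n%:R <= (l1 (x + step j))%:R / n%:R + n%:R^-1 :> R.
  by rewrite e ler_pM2r// natr1 ler_nat.
rewrite /ramp; move: n%:R^-1 ((l1 (x + step j))%:R / n%:R) ((l1 x)%:R / n%:R)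
  n1 h3 h4 => c A B {n0 h1 h2 e} c0 h3 h4.
have clamp (t : R) : [\/ t <= 1 /\ Num.min 1 (Num.max 0 (t - 1)) = 0,
    1 <= t <= 2 /\ Num.min 1 (Num.max 0 (t - 1)) = t - 1 |
    2 <= t /\ Num.min 1 (Num.max 0 (t - 1)) = 1].
  have [t1|/ltW t1] := leP t 1.
    by apply: Or31; rewrite max_l ?min_r ?subr_le0.
  have [t2|/ltW t2] := leP t 2.
    by apply: Or32; rewrite t1 max_r ?subr_ge0// min_r//; lra.
  by apply: Or33; rewrite max_r ?subr_ge0// min_l//; lra.
rewrite ler_norml; case: (clamp A) => -[h5 ->]; case: (clamp B) => -[h6 ->];
by apply/andP; split; lra.
Qed.

Lemma grad_ramp p n u w x : 0 < p -> (0 < n)%N -> (forall y, w y = u y * ramp n y) ->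
  grad p w x <= 2 `^ p * ((n <= l1 x)%N%:R * grad p u x +
    (2 * N)%:R * ((n <= l1 x <= 2 * n)%N%:R * (`|u x| `^ p * n%:R `^ (- p)))).
Proof.
move=> p0 n0 wE.
have n1 : 0 < n%:R :> R by rewrite ltr0n.
have -> : (2 * N)%:R * ((n <= l1 x <= 2 * n)%N%:R * (`|u x| `^ p * n%:R `^ (- p))) =
   \sum_(j : 'I_N * bool) ((n <= l1 x <= 2 * n)%N%:R * (`|u x| `^ p * n%:R `^ (- p))).
  by rewrite sumr_const card_prod card_ord card_bool mulr_natl [(2 * N)%N]mulnC.
rewrite {2}/grad mulr_sumr -big_split mulr_sumr /=; apply: ler_sum => j _.
have -> : w (x + step j) - w x = ramp n (x + step j) * (u (x + step j) - u x) +
    u x * (ramp n (x + step j) - ramp n x) by rewrite !wE; ring.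
apply: (@le_trans _ _ ((`|ramp n (x + step j) * (u (x + step j) - u x)| +
    `|u x * (ramp n (x + step j) - ramp n x)|) `^ p)).
  by apply: ler_powRl; rewrite ?(ltW p0)//; exact: ler_normD.
apply: le_trans (powR_add_le (ltW p0) _ _) _ => //.
have [h1 h2] := l1_step_le x j.
rewrite ler_wpM2l ?powR_ge0// lerD//.
  case: (leqP n (l1 x)) => nx; last first.
    by rewrite ramp_inner ?(leq_trans h1)// mul0r normr0 powR0 ?gt_eqF// mul0r.
  rewrite mul1r; apply: ler_powRl; rewrite ?(ltW p0)// normrM ler_piMl//.
  by rewrite ger0_norm ?ramp_ge0// ramp_le1.
case: (leqP n (l1 x)) => nx /=; last first.
  by rewrite !ramp_inner ?(leq_trans h1) ?(ltnW nx)// subrr mulr0 normr0 powR0 ?gt_eqF// mul0r.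
case: (leqP (l1 x) (2 * n)) => nx'; last first.
  rewrite !ramp_outer// ?(ltnW nx')//; last by rewrite -ltnS (leq_trans nx').
  by rewrite subrr mulr0 normr0 powR0 ?gt_eqF// mul0r.
rewrite mul1r powRN -powR_inv1 ?powR_ge0// -powRrM mulrN1 -mulN1r powRrM powR_inv1 ?ler0n//.
rewrite -powRM ?invr_ge0//; apply: ler_powRl; rewrite ?(ltW p0)// normrM.
by rewrite ler_wpM2l// ramp_lipschitz.
Qed.

Lemma ball_radius_le n : (0 < n)%N -> ((2 * (2 * n)).+1 <= n * 5)%N.
Proof. by lia. Qed.

Lemma succ_le_mul4 d m : (0 < m)%N -> (d <= 2 * m)%N -> (d.+1 <= 4 * m)%N.
Proof. by lia. Qed.

Variables (p q beta alpha tau : R).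
Let theta := p * tau / N%:R.
Hypotheses (p1 : 1 < p) (N0 : (0 < N)%N) (tau0 : 0 <= tau) (tau1 : tau <= 1)
  (alphaE : alpha = beta * (1 - theta) + p * (1 - tau)) (theta1 : theta < 1)
  (qE : q * (1 - theta) = p).

(** With [X] the summand of the mass, the term on the left is at most a constant
    times [X^(1 - theta) (n^-N)^theta], and [delta], [lambda] weight the two factors
    in [powR_interp]. *)
Lemma cutoff_term (delta lambda : R) n u x : (0 < n)%N -> 0 < delta -> 0 < lambda ->
    delta `^ theta * lambda `^ (1 - theta) = 1 ->
  (n <= l1 x <= 2 * n)%N%:R * (wt R x `^ alpha * (`|u x| `^ p * n%:R `^ (- p))) <=
  4 `^ (p * (1 - tau)) * ((l1 x <= 2 * n)%N%:R * (delta * n%:R `^ (- N%:R)) +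
    lambda * ((n <= l1 x)%N%:R * (wt R x `^ beta * `|u x| `^ q))).
Proof.
move=> n0 delta0 lambda0 dl; have p0 : 0 < p by exact: lt_trans ltr01 p1.
have NR : 0 < N%:R :> R by rewrite ltr0n.
have theta0 : 0 <= theta by rewrite divr_ge0 ?mulr_ge0 ?(ltW p0) ?(ltW NR).
have n1 : 0 < n%:R :> R by rewrite ltr0n.
have X0 : 0 <= wt R x `^ beta * `|u x| `^ q by exact: mass_term_ge0.
case: (boolP (n <= l1 x <= 2 * n)%N) => [/andP[h1 h2]|_]; last first.
  rewrite mul0r mulr_ge0 ?powR_ge0// addr_ge0 ?mulr_ge0 ?powR_ge0//; exact: ltW.
rewrite h1 h2 !mul1r.
have [X XE] : {X | X = wt R x `^ beta * `|u x| `^ q} by exists (wt R x `^ beta * `|u x| `^ q).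
rewrite -XE in X0 *.
have wtn : wt R x <= 4 * n%:R.
  by rewrite /wt addrC natr1 -natrM ler_nat; exact: succ_le_mul4.
have e1 : wt R x `^ alpha * (`|u x| `^ p * n%:R `^ (- p)) =
    X `^ (1 - theta) * wt R x `^ (p * (1 - tau)) * n%:R `^ (- p).
  rewrite XE powRM ?powR_ge0// -!powRrM qE alphaE powRD; last first.
    by apply/implyP => _; rewrite gt_eqF ?wt_gt0.
  by ring.
rewrite e1; apply: (@le_trans _ _
    (X `^ (1 - theta) * (4 * n%:R) `^ (p * (1 - tau)) * n%:R `^ (- p))).
  rewrite ler_wpM2r ?powR_ge0// ler_wpM2l ?powR_ge0// ler_powRl ?wt_ge0//.
  by rewrite mulr_ge0 ?(ltW p0)// subr_ge0.
have e2 : X `^ (1 - theta) * (4 * n%:R) `^ (p * (1 - tau)) * n%:R `^ (- p) =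
    4 `^ (p * (1 - tau)) * ((delta * n%:R `^ (- N%:R)) `^ theta * (lambda * X) `^ (1 - theta)).
  rewrite !powRM ?powR_ge0 ?(ltW delta0) ?(ltW lambda0) ?(ltW n1)//.
  rewrite -(powRrM n%:R (- N%:R) theta).
  have -> : n%:R `^ (- N%:R * theta) = n%:R `^ (p * (1 - tau)) * n%:R `^ (- p).
    rewrite -powRD; last by apply/implyP => _; rewrite gt_eqF.
    by congr (_ `^ _); rewrite /theta; field; rewrite gt_eqF.
  transitivity (4 `^ (p * (1 - tau)) * ((delta `^ theta * lambda `^ (1 - theta)) *
    (n%:R `^ (p * (1 - tau)) * n%:R `^ (- p) * X `^ (1 - theta)))); last by ring.
  by rewrite dl; ring.
rewrite e2 ler_wpM2l ?powR_ge0//; apply: powR_interp.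
- by rewrite theta0 ltW.
- by rewrite mulr_ge0 ?powR_ge0// ltW.
- by rewrite mulr_ge0// ltW.
Qed.

(** Choose [delta] so that the contribution of the shell volume is below [e / 3],
    then [n] so that the tails of the energy and of [lambda] times the mass are. *)
Lemma cutoff_approx u e : (mass beta q u < +oo)%E -> (energy alpha p u < +oo)%E ->
    0 < e ->
  exists v, [/\ finitely_supported v, (energy alpha p (v \- u)%R < e%:E)%E &
    (mass beta q (v \- u)%R < e%:E)%E].
Proof.
move=> mu eu e0; have p0 : 0 < p by exact: lt_trans ltr01 p1.
have q0 : 0 < q.
  have h : 0 < 1 - theta by rewrite subr_gt0.
  by rewrite -(pmulr_lgt0 q h) qE.
have [K1 K1E] : {K | K = 2 `^ p * (2 * N)%:R * 4 `^ (p * (1 - tau))}.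
  by exists (2 `^ p * (2 * N)%:R * 4 `^ (p * (1 - tau))).
have [K2 K2E] : {K : R | K = 2 `^ p} by exists (2 `^ p).
have K10 : 0 <= K1 by rewrite K1E !mulr_ge0 ?powR_ge0.
have K20 : 0 <= K2 by rewrite K2E powR_ge0.
have c50 : 0 <= K1 * (5 ^ N)%:R by rewrite mulr_ge0.
have third_gt0 k : 0 <= k -> 0 < e / (3 * (k + 1)).
  by move=> k0; rewrite divr_gt0// mulr_gt0// ltr_wpDl.
have [delta delta0 deltaE] : exists2 delta, 0 < delta & K1 * (5 ^ N)%:R * delta < e / 3.
  by exists (e / (3 * (K1 * (5 ^ N)%:R + 1))); [exact: third_gt0|exact: third_lt].
have [lambda lambda0 dl] : exists2 lambda, 0 < lambda & delta `^ theta * lambda `^ (1 - theta) = 1.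
  exists (delta `^ (- theta / (1 - theta))); first exact: powR_gt0.
  rewrite -powRrM divfK; last by rewrite gt_eqF// subr_gt0.
  rewrite -powRD; last by apply/implyP => _; rewrite gt_eqF.
  by rewrite subrr powRr0.
have Klambda0 : 0 <= K1 * lambda by rewrite mulr_ge0// ltW.
have [n1 H1] := tail_outside (fun x => energy_term_ge0 alpha p u x) eu (third_gt0 _ K20).
have [n2 H2] := tail_outside (fun x => mass_term_ge0 beta q u x) mu (third_gt0 _ Klambda0).
pose n := (maxn n1 n2).+1.
have {}H1 := H1 n (leqW (leq_maxl _ _)).
have {}H2 := H2 n (leqW (leq_maxr _ _)).
have n0 : (0 < n)%N by [].
move: (n) n0 H1 H2 => {}n n0 H1 H2.
pose w x := u x * ramp n x.
pose v := u \- w.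
exists v; split.
- apply: sub_finite_set (@finite_ball N (2 * n)) => x /=.
  apply: contra_neqT; rewrite -ltnNge => nx.
  by rewrite /v /w /= ramp_outer ?mulr1 ?subrr// ltnW.
- rewrite (@energy_opp R N alpha p w); last by move=> y; rewrite /v /=; ring.
  pose f1 x := (n <= l1 x)%N%:R * (wt R x `^ alpha * grad p u x).
  pose f2 x := (l1 (x : lattice N) <= 2 * n)%N%:R * (delta * n%:R `^ (- N%:R)).
  pose f3 x := (n <= l1 x)%N%:R * (wt R x `^ beta * `|u x| `^ q).
  have f10 x : 0 <= f1 x by rewrite mulr_ge0 ?energy_term_ge0.
  have f20 x : 0 <= f2 x by rewrite !mulr_ge0 ?powR_ge0// ltW.
  have f30 x : 0 <= f3 x by rewrite mulr_ge0 ?mass_term_ge0.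
  have pt x : wt R x `^ alpha * grad p w x <= K2 * f1 x + (K1 * f2 x + K1 * lambda * f3 x).
    have h1 := @grad_ramp p n u w x p0 n0 (fun=> erefl).
    have h2 := @cutoff_term delta lambda n u x n0 delta0 lambda0 dl.
    apply: le_trans (ler_wpM2l (powR_ge0 _ _) h1) _.
    rewrite -K2E (_ : wt R x `^ alpha * _ = K2 * f1 x + K2 * (2 * N)%:R *
      ((n <= l1 x <= 2 * n)%N%:R * (wt R x `^ alpha * (`|u x| `^ p * n%:R `^ (- p))))); last first.
      by rewrite /f1; ring.
    rewrite lerD2l; apply: le_trans (ler_wpM2l _ h2) _; first by rewrite mulr_ge0.
    by rewrite /f2 /f3 K1E K2E le_eqVlt; apply/orP; left; apply/eqP; ring.
  apply: le_lt_trans (le_tsum pt) _.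
  rewrite tsumD; [|by move=> x; rewrite mulr_ge0|by move=> x; rewrite addr_ge0// mulr_ge0].
  rewrite tsumD; [|by move=> x; rewrite mulr_ge0|by move=> x; rewrite mulr_ge0].
  rewrite !tsumZ//.
  have h2 : (tsum f2 <= (delta * (5 ^ N)%:R)%:E)%E.
    apply: le_trans (tsum_ball _ _ _) _; first by rewrite mulr_ge0 ?powR_ge0// ltW.
    have nR : 0 < n%:R :> R by rewrite ltr0n.
    rewrite lee_fin -mulrA ler_wpM2l ?(ltW delta0)// powR_invn ?(ltW nR)//.
    rewrite ler_pdivrMl ?exprn_gt0// -natrX -natrM ler_nat -expnMn leq_exp2r//.
    exact: ball_radius_le.
  have h1 : (K2%:E * tsum f1 <= (K2 * (e / (3 * (K2 + 1))))%:E)%E.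
    by rewrite [in leRHS]EFinM; apply: lee_wpmul2l => //; exact: ltW.
  have h3 : ((K1 * lambda)%:E * tsum f3 <= (K1 * lambda * (e / (3 * (K1 * lambda + 1))))%:E)%E.
    by rewrite [in leRHS]EFinM; apply: lee_wpmul2l => //; exact: ltW.
  have {}h2 : (K1%:E * tsum f2 <= (K1 * (5 ^ N)%:R * delta)%:E)%E.
    rewrite (_ : K1 * (5 ^ N)%:R * delta = K1 * (delta * (5 ^ N)%:R)); last by ring.
    by rewrite [in leRHS]EFinM; apply: lee_wpmul2l.
  apply: le_lt_trans (leeD h1 (leeD h2 h3)) _.
  rewrite -!EFinD lte_fin.
  by apply: add_thirds => //; exact: third_lt.
- rewrite (@mass_opp R N beta q w); last by move=> y; rewrite /v /=; ring.
  apply: le_lt_trans (_ : (_ <= \tsum_(x) ((n <= l1 x)%N%:R * (wt R x `^ beta * `|u x| `^ q)))%E) _.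
    apply: le_tsum => x; case: (leqP n (l1 x)) => nx.
      rewrite mul1r ler_wpM2l ?powR_ge0//; apply: ler_powRl; rewrite ?(ltW q0)//.
      by rewrite /w normrM ler_piMr// ger0_norm ?ramp_ge0// ramp_le1.
    by rewrite /w ramp_inner ?(ltnW nx)// mulr0 normr0 powR0 ?gt_eqF// mulr0 mul0r.
  apply: lt_trans H2 _; rewrite lte_fin ltr_pdivrMr; last first.
    by rewrite mulr_gt0// ltr_wpDl.
  by rewrite ltr_pMr//; exact: one_lt_3S.
Qed.

End cutoff.

(** * Limits *)

Section vanishing.
Variable R : realType.
Implicit Types (g h : nat -> \bar R) (K e : R).

Definition vanishes g := forall e : R, 0 < e ->
  exists n0 : nat, forall n, (n0 <= n)%N -> (g n < e%:E)%E.

Definition vanishes2 (g : nat -> nat -> \bar R) := forall e : R, 0 < e ->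
  exists n0 : nat, forall k n, (n0 <= k)%N -> (n0 <= n)%N -> (g k n < e%:E)%E.

Lemma half_share_gt0 K e : 0 <= K -> 0 < e -> 0 < e / (2 * (K + 1)).
Proof. by move=> K0 e0; rewrite divr_gt0// mulr_gt0// ltr_wpDl. Qed.

Lemma combine_lt K e (X Y : \bar R) : 0 <= K -> 0 < e ->
  (X < (e / (2 * (K + 1)))%:E)%E -> (Y < (e / (2 * (K + 1)))%:E)%E ->
  (K%:E * (X + Y) < e%:E)%E.
Proof.
move=> K0 e0 Xl Yl; have d0 := half_share_gt0 K0 e0.
apply: (@le_lt_trans _ _ (K%:E * (e / (2 * (K + 1)) + e / (2 * (K + 1)))%:E)%E).
  by apply: lee_wpmul2l => //; rewrite EFinD; apply: leeD; exact: ltW.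
rewrite -EFinM lte_fin; set d := e / _ in d0 *.
have -> : e = (K + 1) * (d + d) by rewrite /d; field; rewrite gt_eqF// ltr_wpDl.
by rewrite mulrDl mul1r ltrDl addr_gt0.
Qed.

Lemma vanishesD K (g h k : nat -> \bar R) : 0 <= K ->
    (forall n, (g n <= K%:E * (h n + k n))%E) -> vanishes h -> vanishes k ->
  vanishes g.
Proof.
move=> K0 ghk vh vk e e0; have d0 := half_share_gt0 K0 e0.
have [n1 H1] := vh _ d0; have [n2 H2] := vk _ d0.
exists (maxn n1 n2) => n; rewrite geq_max => /andP[/H1 h1 /H2 h2].
exact: le_lt_trans (ghk n) (combine_lt K0 e0 h1 h2).
Qed.

Lemma vanishes2D K (g : nat -> nat -> \bar R) h : 0 <= K ->
  (forall k n, (g k n <= K%:E * (h k + h n))%E) -> vanishes h -> vanishes2 g.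
Proof.
move=> K0 ghh vh e e0; have d0 := half_share_gt0 K0 e0.
have [n1 H1] := vh _ d0; exists n1 => k n /H1 h1 /H1 h2.
exact: le_lt_trans (ghh k n) (combine_lt K0 e0 h1 h2).
Qed.

Lemma vanishes_harmonic g : (forall n, (g n < (n.+1%:R^-1)%:E)%E) -> vanishes g.
Proof.
move=> gn e e0; exists (Num.truncn e^-1).+1 => n hn.
apply: lt_trans (gn n) _; rewrite lte_fin -[ltRHS]invrK ltf_pV2 ?posrE ?invr_gt0//.
have e1 : 0 <= e^-1 by rewrite invr_ge0 ltW.
have /andP[_ h] := truncn_itv e1.
by apply: lt_le_trans h _; rewrite ler_nat ltnW.
Qed.

End vanishing.

Section limits.
Variables (R : realType) (N : nat).
Implicit Types (u v : lattice N -> R) (f h : nat -> lattice N -> R) (x y : lattice N).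

Definition vanishes_ptws h := forall x (e : R), 0 < e ->
  exists n0 : nat, forall n, (n0 <= n)%N -> `|h n x| <= e.

Lemma mass_term_lt beta q v x e : 0 < q -> 0 < e ->
  (mass beta q v < (wt R x `^ beta * e `^ q)%:E)%E -> `|v x| < e.
Proof.
move=> q0 e0 h; rewrite ltNge; apply/negP => le.
suff : ((wt R x `^ beta * e `^ q)%:E <= mass beta q v)%E by rewrite leNgt h.
apply: le_trans (tsum_ge_term x (mass_term_ge0 beta q v)).
by rewrite lee_fin ler_wpM2l ?powR_ge0// ler_powRl ?(ltW q0)// ltW.
Qed.

Lemma mass_vanishes_ptws beta q h : 0 < q ->
  vanishes (fun n => mass beta q (h n)) -> vanishes_ptws h.
Proof.
move=> q0 vm x e e0.
have [n0 H] := vm _ (mulr_gt0 (powR_gt0 beta (wt_gt0 R x)) (powR_gt0 q e0)).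
by exists n0 => n /H /(mass_term_lt q0 e0)/ltW.
Qed.

Lemma grad_vanishes p h x : 0 < p -> vanishes_ptws h ->
  forall e, 0 < e -> exists n0 : nat, forall n, (n0 <= n)%N -> grad p (h n) x <= e.
Proof.
move=> p0 vv e e0; pose M : R := (2 * N)%:R.
have M0 : 0 <= M by [].
have eM0 : 0 < e / (M + 1) by rewrite divr_gt0// ltr_wpDl.
pose d := (e / (M + 1)) `^ p^-1 / 2.
have d0 : 0 < d by rewrite divr_gt0// powR_gt0.
have [n1 H1] := vv x d d0.
have /choice[nj Hj] (j : 'I_N * bool) := vv (x + step j) d d0.
exists (maxn n1 (\max_j nj j)) => n; rewrite geq_max => /andP[/H1 h1 /bigmax_leqP h2].
have dp : (d + d) `^ p = e / (M + 1).
  rewrite -splitr -powRrM mulVf ?gt_eqF// powRr1//; exact: ltW.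
apply: (@le_trans _ _ (\sum_(j : 'I_N * bool) (d + d) `^ p)).
  apply: ler_sum => j _; apply: ler_powRl; rewrite ?(ltW p0)//.
  apply: le_trans (ler_normB _ _) _; rewrite lerD//.
  by apply: Hj; exact: h2.
rewrite sumr_const card_prod card_ord card_bool dp -mulr_natl mulnC -/M.
by rewrite mulrA ler_pdivrMr ?ltr_wpDl// mulrC ler_wpM2l ?(ltW e0)// lerDl.
Qed.

Lemma energy_fatou alpha p f u : 0 < p -> vanishes_ptws (fun n => f n \- u) ->
    vanishes2 (fun k n => energy alpha p (f k \- f n)) ->
  vanishes (fun n => energy alpha p (f n \- u)).
Proof.
move=> p0 fu fc e e0.
have K0 : 0 < (2 : R) `^ p by exact: powR_gt0.
move: (2 `^ p) K0 (@grad_triangle R N p) => K K0 tri.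
have d0 : 0 < e / (K + 1) by rewrite divr_gt0// addr_gt0.
have [n0 H] := fc _ d0; exists n0 => n hn.
apply: (@le_lt_trans _ _ (K%:E * (e / (K + 1))%:E)%E); last first.
  rewrite -EFinM lte_fin mulrA ltr_pdivrMr ?addr_gt0// mulrC ltr_pM2l//.
  by rewrite ltrDl.
apply: (@tsum_fatou _ _ _ (fun m x => K * (wt R x `^ alpha * grad p (f n \- f m) x))
  (fun m x => K * (wt R x `^ alpha * grad p (f m \- u) x)) _ n0).
- by move=> m x; rewrite mulr_ge0 ?(ltW K0) ?energy_term_ge0.
- move=> m x; rewrite -mulrDr -mulrDr mulrCA ler_wpM2l ?powR_ge0//.
  apply: tri; first exact: ltW.
  by move=> y /=; rewrite addrA subrK.
- move=> x e1 e10.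
  have w0 : 0 < K * wt R x `^ alpha by rewrite mulr_gt0 ?powR_gt0 ?wt_gt0.
  have [n1 H1] := grad_vanishes x p0 fu (divr_gt0 e10 w0).
  exists n1 => m /H1 h; rewrite mulrA mulrC -ler_pdivlMr//.
- move=> m hm; rewrite tsumZ ?(ltW K0)//; last by move=> x; exact: energy_term_ge0.
  apply: lee_wpmul2l; first by rewrite lee_fin ltW.
  exact/ltW/H.
Qed.

Lemma mass_fatou beta q f u : 0 < q -> vanishes_ptws (fun n => f n \- u) ->
    vanishes2 (fun k n => mass beta q (f k \- f n)) ->
  vanishes (fun n => mass beta q (f n \- u)).
Proof.
move=> q0 fu fc e e0.
have K0 : 0 < (2 : R) `^ q by exact: powR_gt0.
move: (2 `^ q) K0 (@powR_add_le R q) => K K0 tri.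
have d0 : 0 < e / (K + 1) by rewrite divr_gt0// addr_gt0.
have [n0 H] := fc _ d0; exists n0 => n hn.
apply: (@le_lt_trans _ _ (K%:E * (e / (K + 1))%:E)%E); last first.
  rewrite -EFinM lte_fin mulrA ltr_pdivrMr ?addr_gt0// mulrC ltr_pM2l//.
  by rewrite ltrDl.
apply: (@tsum_fatou _ _ _ (fun m x => K * (wt R x `^ beta * `|(f n \- f m) x| `^ q))
  (fun m x => K * (wt R x `^ beta * `|(f m \- u) x| `^ q)) _ n0).
- by move=> m x; rewrite mulr_ge0 ?(ltW K0) ?mass_term_ge0.
- move=> m x; rewrite -mulrDr -mulrDr mulrCA ler_wpM2l ?powR_ge0//.
  apply: le_trans (tri _ _ (ltW q0) (normr_ge0 _) (normr_ge0 _)).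
  apply: ler_powRl; rewrite ?(ltW q0)//= -(subrKA (f m x)).
  exact: ler_normD.
- move=> x e1 e10.
  have w0 : 0 < K * wt R x `^ beta by rewrite mulr_gt0 ?powR_gt0 ?wt_gt0.
  have [n1 H1] := fu x _ (powR_gt0 q^-1 (divr_gt0 e10 w0)).
  exists n1 => m /H1 h; rewrite mulrA mulrC -ler_pdivlMr//.
  apply: le_trans (ler_powRl (ltW q0) (normr_ge0 _) h) _.
  by rewrite -powRrM mulVf ?gt_eqF// powRr1// ltW// divr_gt0.
- move=> m hm; rewrite tsumZ ?(ltW K0)//; last by move=> x; exact: mass_term_ge0.
  apply: lee_wpmul2l; first by rewrite lee_fin ltW.
  exact/ltW/H.
Qed.

(** Each value is controlled by the mass, so the sequence is Cauchy pointwise. *)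
Lemma mass_cauchy_limit beta q f : 0 < q ->
    vanishes2 (fun k n => mass beta q (f k \- f n)) ->
  exists u, vanishes_ptws (fun n => f n \- u).
Proof.
move=> q0 fc.
have cv x : cvg (f n x @[n --> \oo]).
  apply: cauchy_cvg; apply: cauchy_exP => e e0; rewrite /cauchy_ex.
  have [n0 H] := fc _ (mulr_gt0 (powR_gt0 beta (wt_gt0 R x)) (powR_gt0 q e0)).
  exists (f n0 x); exists n0 => // n hn.
  exact: (mass_term_lt q0 e0 (H n0 n (leqnn _) hn)).
exists (fun x => lim (f n x @[n --> \oo])) => x e e0.
have /cvgrPdist_le/(_ e e0)[n0 _ H] := cv x.
by exists n0 => n /H /=; rewrite distrC.
Qed.

End limits.

(** * The two spaces and the completion *)

Section spaces.
Variables (R : realType) (N : nat) (p a b : R).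
Let q : R := qstar N p a b.
Let tau : R := 1 - (a - b).
Let theta : R := p * tau / N%:R.
Hypotheses (hN : (1 <= N)%N) (p1 : 1 < p) (hab0 : 0 <= a - b) (hab1 : a - b <= 1)
  (hq : 1 < q).
Implicit Types (u v w : lattice N -> R) (f g : nat -> lattice N -> R).

Let p0 : 0 < p. Proof. exact: lt_trans ltr01 p1. Qed.
Let q0 : 0 < q. Proof. exact: lt_trans ltr01 hq. Qed.
Let NR : 0 < N%:R :> R. Proof. by rewrite ltr0n. Qed.
Let tau0 : 0 <= tau. Proof. by rewrite subr_ge0. Qed.
Let tau1 : tau <= 1. Proof. by rewrite gerBl. Qed.

Let den_gt0 : 0 < N%:R - p + p * (a - b).
Proof.
rewrite ltNge; apply/negP => den; move: q0; rewrite ltNge /q /qstar.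
by rewrite mulr_ge0_le0 ?invr_le0// mulr_ge0// ltW.
Qed.

Let qE : q * (1 - theta) = p.
Proof.
by rewrite /q /qstar /theta /tau; field; rewrite !gt_eqF.
Qed.

Let theta1 : theta < 1.
Proof. by rewrite -subr_gt0 -(pmulr_rgt0 _ q0) qE. Qed.

Let alphaE : a * p = b * q * (1 - theta) + p * (1 - tau).
Proof. by rewrite -mulrA qE /tau; ring. Qed.

Lemma D_spaceP u : @D_space R N p a b u <->
  (mass (b * q) q u < +oo)%E /\ (energy (a * p) p u < +oo)%E.
Proof.
rewrite /D_space /lb_space /= -/q.
by rewrite (norm_lty q0 (lb_normE b q)) (norm_lty p0 (D_normE a p)).
Qed.

Lemma D_space0P u : @D_space0 R N p a b u <->
  exists f, [/\ forall n, finitely_supported (f n),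
    vanishes2 (fun k n => energy (a * p) p (f k \- f n)) &
    vanishes (fun n => mass (b * q) q (f n \- u))].
Proof.
split=> -[f [ff fc fu]]; exists f; split=> //.
- exact/(norm_cauchyP p0 (energy_ge0 _ _) (D_normE a p)).
- exact/(norm_cvgP q0 (mass_ge0 _ _) (lb_normE b q)).
- exact/(norm_cauchyP p0 (energy_ge0 _ _) (D_normE a p)).
- exact/(norm_cvgP q0 (mass_ge0 _ _) (lb_normE b q)).
Qed.

Lemma energy_sym u v : energy (a * p) p (u \- v) = energy (a * p) p (v \- u).
Proof. by apply: energy_opp => y /=; rewrite opprB. Qed.

Lemma mass_sym u v : mass (b * q) q (u \- v) = mass (b * q) q (v \- u).
Proof. by apply: mass_opp => y /=; rewrite opprB. Qed.

Lemma energy_dist u v w :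
  (energy (a * p) p (u \- w)%R <= (2 `^ p)%:E *
    (energy (a * p) p (u \- v)%R + energy (a * p) p (w \- v)%R))%E.
Proof.
rewrite (energy_sym w v).
by apply: energy_triangle; [exact: ltW|move=> y /=; rewrite subrKA].
Qed.

Lemma D_space_dense u : @D_space R N p a b u ->
  exists f, [/\ forall n, finitely_supported (f n),
    vanishes (fun n => energy (a * p) p (f n \- u)) &
    vanishes (fun n => mass (b * q) q (f n \- u))].
Proof.
move=> /D_spaceP[mu eu].
have h n : 0 < n.+1%:R^-1 :> R by rewrite invr_gt0 ltr0n.
have /choice[f fP] n := cutoff_approx p1 hN tau0 tau1 alphaE theta1 qE mu eu (h n).
exists f; split.
- by move=> n; have [] := fP n.
- by apply: vanishes_harmonic => n; have [] := fP n.
- by apply: vanishes_harmonic => n; have [] := fP n.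
Qed.

Lemma D_space0_energy_cvg f u : vanishes2 (fun k n => energy (a * p) p (f k \- f n)) ->
    vanishes (fun n => mass (b * q) q (f n \- u)) ->
  vanishes (fun n => energy (a * p) p (f n \- u)).
Proof.
by move=> fc fu; apply: energy_fatou => //; exact: mass_vanishes_ptws q0 fu.
Qed.

Lemma D_space_close v u : finitely_supported v ->
  (energy (a * p) p (v \- u)%R < +oo)%E -> (mass (b * q) q (v \- u)%R < +oo)%E ->
  @D_space R N p a b u.
Proof.
move=> fv eu mu; apply/D_spaceP.
have [r _ rE] := energy_fin (a * p) p0 fv.
have [s _ sE] := mass_fin (b * q) q0 fv.
split.
- apply: (@le_lt_trans _ _ ((2 `^ q)%:E * (mass (b * q) q (v \- u)%R + mass (b * q) q v))%E).
    rewrite (mass_sym v u).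
    by apply: mass_triangle; [exact: ltW|move=> y /=; rewrite subrK].
  by rewrite lte_mul_pinfty ?lee_fin ?powR_ge0// sE lte_add_pinfty// ltry.
- apply: (@le_lt_trans _ _ ((2 `^ p)%:E * (energy (a * p) p (v \- u)%R + energy (a * p) p v))%E).
    rewrite (energy_sym v u).
    by apply: energy_triangle; [exact: ltW|move=> y /=; rewrite subrK].
  by rewrite lte_mul_pinfty ?lee_fin ?powR_ge0// rE lte_add_pinfty// ltry.
Qed.

Lemma D_space0E : @D_space0 R N p a b = @D_space R N p a b.
Proof.
apply/seteqP; split=> u.
  move=> /D_space0P[f [ff fc fu]].
  have fe := D_space0_energy_cvg fc fu.
  have [n1 H1] := fe _ ltr01; have [n2 H2] := fu _ ltr01.
  apply: (@D_space_close (f (maxn n1 n2))) => //.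
    by rewrite (lt_trans (H1 _ (leq_maxl _ _)))// ltry.
  by rewrite (lt_trans (H2 _ (leq_maxr _ _)))// ltry.
move=> /D_space_dense[f [ff fe fu]]; apply/D_space0P; exists f; split=> //.
apply: vanishes2D (powR_ge0 2 p) _ fe => k n; exact: energy_dist.
Qed.

Hypothesis hb : 0 < q^-1 + b / N%:R.

Let hHardy : 0 < N%:R + (a * p - p).
Proof.
have e : q^-1 + b / N%:R = (N%:R + (a * p - p)) / (N%:R * p).
  by rewrite /q /qstar; field; rewrite !gt_eqF.
by move: hb; rewrite e pmulr_lgt0 // invr_gt0 mulr_gt0.
Qed.

Lemma mass_small_of_energy (e : R) : 0 < e -> exists2 d : R, 0 < d &
  forall u, finitely_supported u ->
    (energy (a * p) p u < d%:E)%E -> (mass (b * q) q u < e%:E)%E.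
Proof.
move=> e0; have [C C0 H] := weighted_sobolev p1 hN tau0 tau1 alphaE theta1 qE hHardy.
have C1 : 0 < C + 1 by rewrite ltr_wpDl.
have theta' : 0 <= 1 - theta by rewrite subr_ge0 ltW.
have e10 : 0 < e `^ (1 - theta) by exact: powR_gt0.
exists (e `^ (1 - theta) / (C + 1)); first by rewrite divr_gt0.
move=> u fu; have [P P0 PE] := energy_fin (a * p) p0 fu.
have [M M0 ME] := mass_fin (b * q) q0 fu.
rewrite PE ME !lte_fin => Pl; rewrite ltNge; apply/negP => eM.
have h1 := H u M P fu ME PE.
have h2 : e `^ (1 - theta) <= M `^ (1 - theta) by apply: ler_powRl => //; exact: ltW.
have : e `^ (1 - theta) <= (C + 1) * P.
  by apply: le_trans h2 (le_trans h1 _); rewrite ler_wpM2r// lerDl.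
by rewrite leNgt mulrC -ltr_pdivlMr// Pl.
Qed.

Lemma mass_vanishes_of_energy f : (forall n, finitely_supported (f n)) ->
  vanishes (fun n => energy (a * p) p (f n)) -> vanishes (fun n => mass (b * q) q (f n)).
Proof.
move=> ff fe e e0; have [d d0 H] := mass_small_of_energy e0.
by have [n0 H0] := fe _ d0; exists n0 => n /H0; exact: H.
Qed.

Lemma finitely_supported_sub u v : finitely_supported u -> finitely_supported v ->
  finitely_supported (u \- v).
Proof.
move=> fu fv; apply: (@sub_finite_set _ _ ([set x | u x != 0] `|` [set x | v x != 0])).
  move=> x /= uv; have [ux|] := eqVneq (u x) 0; last by left.
  by right; apply: contra_neq uv => vx; rewrite ux vx subrr.
by rewrite finite_setU.
Qed.

Lemma mass_cauchy_of_energy f : (forall n, finitely_supported (f n)) ->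
    vanishes2 (fun k n => energy (a * p) p (f k \- f n)) ->
  vanishes2 (fun k n => mass (b * q) q (f k \- f n)).
Proof.
move=> ff fe e e0; have [d d0 H] := mass_small_of_energy e0.
have [n0 H0] := fe _ d0; exists n0 => k n hk hn; apply: H (H0 k n hk hn).
exact: finitely_supported_sub.
Qed.

(** Finitely supported [f n] that approximate [u] have energy tending to that of
    [u], which is zero; so their mass tends to [0] by the Sobolev inequality and [u]
    has mass zero. *)
Lemma energy_separates u : @D_space R N p a b u -> energy (a * p) p u = 0%E ->
  u = cst 0.
Proof.
move=> Du eu0; have [f [ff fe fm]] := D_space_dense Du.
have fe' : vanishes (fun n => energy (a * p) p (f n)).
  apply: (vanishesD (powR_ge0 2 p) _ fe (k := fun=> energy (a * p) p u)).
    by move=> n; apply: energy_triangle; [exact: ltW|move=> y /=; rewrite subrK].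
  by move=> e e0; exists 0%N => n _; rewrite eu0.
have fm' := mass_vanishes_of_energy ff fe'.
have mu : vanishes (fun=> mass (b * q) q u).
  apply: (vanishesD (powR_ge0 2 q) _ fm' fm) => n.
  rewrite (mass_sym (f n) u).
  by apply: mass_triangle; [exact: ltW|move=> y /=; rewrite addrC subrK].
have small x e : 0 < e -> `|u x| < e.
  move=> e0; have [n0 /(_ n0 (leqnn _))] :=
    mu _ (mulr_gt0 (powR_gt0 (b * q) (wt_gt0 R x)) (powR_gt0 q e0)).
  exact: mass_term_lt.
apply/funext => x; apply/eqP; rewrite -normr_eq0; apply: contraT => ux.
by have := small x `|u x|; rewrite ltxx normr_gt0 -normr_eq0; apply.
Qed.

(** Replace [f] by finitely supported [g] with the same limit.  The Sobolev
    inequality makes [g] Cauchy in mass; its pointwise limit is the limit in mass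
    and, by Fatou, in energy. *)
Lemma D_space_complete f : (forall n, @D_space R N p a b (f n)) ->
    vanishes2 (fun k n => energy (a * p) p (f k \- f n)) ->
  exists u, @D_space0 R N p a b u /\ vanishes (fun n => energy (a * p) p (f n \- u)).
Proof.
move=> Df fc.
have h n : 0 < n.+1%:R^-1 :> R by rewrite invr_gt0 ltr0n.
have approx n : exists v, finitely_supported v /\
    (energy (a * p) p (v \- f n)%R < (n.+1%:R^-1)%:E)%E.
  have [g [gg ge _]] := D_space_dense (Df n).
  by have [n0 /(_ n0 (leqnn _)) ?] := ge _ (h n); exists (g n0).
have /choice[g gP] := approx.
have gg n : finitely_supported (g n) by have [] := gP n.
have gf : vanishes (fun n => energy (a * p) p (g n \- f n)).
  by apply: vanishes_harmonic => n; have [] := gP n.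
have K0 : 0 <= 2 `^ p :> R by exact: powR_ge0.
have gc : vanishes2 (fun k n => energy (a * p) p (g k \- g n)).
  move=> e e0; have d0 := half_share_gt0 K0 e0.
  have d1 := half_share_gt0 K0 d0.
  have [n1 H1] := gf _ d0; have [n2 H2] := gf _ d1; have [n3 H3] := fc _ d1.
  exists (maxn n1 (maxn n2 n3)) => k n; rewrite !geq_max.
  move=> /and3P[/H1 k1 /H2 k2 k3] /and3P[n1' /H2 n2' n3'].
  apply: le_lt_trans (energy_dist _ (f k) _) (combine_lt K0 e0 k1 _).
  apply: le_lt_trans (energy_dist _ (f n) _) (combine_lt K0 d0 n2' _).
  exact: H3.
have mc := mass_cauchy_of_energy gg gc.
have [u gu] := mass_cauchy_limit q0 mc.
have gmu := mass_fatou q0 gu mc.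
have geu := energy_fatou p0 gu gc.
exists u; split; first by apply/D_space0P; exists g.
apply: (vanishesD K0 _ (h := fun n => energy (a * p) p (g n \- f n))
  (k := fun n => energy (a * p) p (g n \- u))) => // n.
rewrite (energy_sym (g n) (f n)) (energy_sym (g n) u); exact: energy_dist.
Qed.

Lemma D_space_completion :
  is_completion (@D_norm R N a p) (@finitely_supported R N) (@D_space R N p a b).
Proof.
have nE := D_normE (N := N) a p; have n0 := energy_ge0 (R := R) (N := N) (a * p) p.
split.
- move=> u fu; apply/D_spaceP.
  have [r _ ->] := energy_fin (a * p) p0 fu.
  by have [s _ ->] := mass_fin (b * q) q0 fu; rewrite !ltry.
- by move=> u /D_spaceP[_]; rewrite (norm_lty p0 nE).
- move=> u v /D_spaceP[mu eu] /D_spaceP[mv ev] /(norm_eq0 n0 nE) uv.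
  apply/funext => x; apply/eqP; rewrite -subr_eq0; apply/eqP.
  rewrite -[LHS]/((u \- v) x) (energy_separates _ uv)//; apply/D_spaceP.
  rewrite uv ltry; split=> //.
  apply: (@le_lt_trans _ _ ((2 `^ q)%:E * (mass (b * q) q u + mass (b * q) q v))%E).
    rewrite -(@mass_opp _ _ _ _ v (\- v))//.
    by apply: mass_triangle => //; exact: ltW.
  by rewrite lte_mul_pinfty ?lee_fin ?powR_ge0// lte_add_pinfty.
- move=> u /D_space_dense[f [ff fe _]]; exists f; split=> //.
  exact/(norm_cvgP p0 n0 nE).
- move=> f Df /(norm_cauchyP p0 n0 nE) fc.
  have [u [Du fu]] := D_space_complete Df fc.
  exists u; split; first by rewrite -D_space0E.
  exact/(norm_cvgP p0 n0 nE).
Qed.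

End spaces.

Theorem theorem3p4 (R : realType) (N : nat) (p a b : R)
  (hN : (1 <= N)%N) (hp : 1 < p)
  (ha : 0 < p^-1 + a / N%:R)
  (hab0 : 0 <= a - b) (hab1 : a - b <= 1)
  (hq : 1 < qstar N p a b) :
  @D_space0 R N p a b = @D_space R N p a b /\
  (0 < (qstar N p a b)^-1 + b / N%:R ->
   is_completion (@D_norm R N a p) (@finitely_supported R N)
     (@D_space0 R N p a b)).
Proof.
have e := D_space0E hN hp hab0 hab1 hq.
by split=> // hb; rewrite e; exact: D_space_completion.
Qed.
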